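(* Let $f:\mathbb{R}^2\to[0,\infty)$ be a specified bivariate Lebesgue probability density function satisfying $f(z_1,z_2)=f(z_2,z_1)=f(-z_1,-z_2)$ for all $(z_1,z_2)\in\mathbb{R}^2$. Let $\mathbf{X}=(X_1,X_2)$ have density $f(x_1-\theta_1,x_2-\theta_2)$, where the unknown $\boldsymbol\theta=(\theta_1,\theta_2)$ lies in $\Theta_0=\{(\theta_1,\theta_2):-\infty<\theta_1\le\theta_2<\infty\}$. Let $W:\mathbb{R}\to[0,\infty)$ be absolutely continuous with $W(0)=0$, $W(t)=W(-t)$ for all $t$, $W$ strictly decreasing on $(-\infty,0)$ and strictly increasing on $(0,\infty)$, and $W'$ increasing almost everywhere. Consider the loss $L(\boldsymbol\theta,\mathbf a)=W(a_1-\theta_1)+W(a_2-\theta_2)$, $\mathbf a\in\mathbb{R}^2$, with risk $R(\boldsymbol\theta,\boldsymbol\delta)=E_{\boldsymbol\theta}[L(\boldsymbol\theta,\boldsymbol\delta(\mathbf X))]$. Let $D=X_2-X_1$, $\boldsymbol\delta_0(\mathbf X)=(X_1,X_2)$, and for $\psi:\mathbb{R}\to\mathbb{R}$ let $\boldsymbol\delta_\psi(\mathbf X)=(X_1-\psi(D),X_2+\psi(D))$. Suppose $\lim_{t\to\infty}\psi(t)=0$ and that one of the following holds: (a) $\psi$ is decreasing and $\displaystyle\int_{-\infty}^{\infty}\int_{-\infty}^{t}W'(s-\psi(t))\,f(s,s+y)\,dy\,ds\ge 0$ for all $t\in\mathbb{R}$; or (b) $\psi$ is increasing and $\displaystyle\int_{-\infty}^{\infty}\int_{-\infty}^{t}W'(s-\psi(t))\,f(s,s+y)\,dy\,ds\le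 0$ for all $t\in\mathbb{R}$. Then $R(\boldsymbol\theta,\boldsymbol\delta_\psi)\le R(\boldsymbol\theta,\boldsymbol\delta_0)$ for all $\boldsymbol\theta\in\Theta_0$. *)

(* Defs.v *)
From HB Require Import structures.
From mathcomp Require Import all_boot all_order all_algebra.
From mathcomp Require Import all_classical all_reals all_analysis.
Set Implicit Arguments. Unset Strict Implicit. Unset Printing Implicit Defensive.
Import Order.TTheory GRing.Theory Num.Theory.
Import numFieldNormedType.Exports.
Local Open Scope classical_set_scope.
Local Open Scope ring_scope.

Definition leb2 (R : realType) :=
  ((@lebesgue_measure R) \x (@lebesgue_measure R))%E.

Definition abs_continuous_on (R : realType) (a b : R) (W : R -> R) : Prop :=
  forall eps : R, 0 < eps -> exists2 d : R, 0 < d &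
    forall (n : nat) (u v : nat -> R),
      (forall i, (i < n)%N -> a <= u i /\ u i <= v i /\ v i <= b) ->
      (forall i, (i.+1 < n)%N -> v i <= u i.+1) ->
      \sum_(i < n) (v i - u i) < d ->
      \sum_(i < n) `|W (v i) - W (u i)| < eps.

Definition abs_continuous (R : realType) (W : R -> R) : Prop :=
  forall a b : R, abs_continuous_on a b W.

Definition prob_density2 (R : realType) (f : R * R -> R) : Prop :=
  measurable_fun setT f /\ (forall z, 0 <= f z) /\
  (\int[@leb2 R]_z (f z)%:E = 1)%E.

(* Risk R(theta, delta) = E_theta[ W(delta_1(X) - theta_1) + W(delta_2(X) - theta_2) ]
   where X has Lebesgue density x |-> f(x_1 - theta_1, x_2 - theta_2). *)
Definition risk (R : realType) (W : R -> R) (f : R * R -> R)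
    (theta : R * R) (delta : R * R -> R * R) : \bar R :=
  (\int[@leb2 R]_x
     ((W ((delta x).1 - theta.1) + W ((delta x).2 - theta.2))
       * f (x.1 - theta.1, x.2 - theta.2))%:E)%E.

Definition delta0 (R : realType) : R * R -> R * R := fun x => x.

Definition delta_psi (R : realType) (psi : R -> R) : R * R -> R * R :=
  fun x => (x.1 - psi (x.2 - x.1), x.2 + psi (x.2 - x.1)).

Definition cond_int (R : realType) (W : R -> R) (f : R * R -> R)
    (psi : R -> R) (t : R) : \bar R :=
  (\int[@lebesgue_measure R]_s
     \int[@lebesgue_measure R]_(y in `]-oo, t])
        ((derive1 W (s - psi t)) * f (s, s + y))%:E)%E.

(* Main.v *)
(* Write X = theta + Z, lam = theta_2 - theta_1 >= 0, D = Z_2 - Z_1. The map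
   (z_1, z_2) -> (- z_2, - z_1) preserves f and D and exchanges the two
   components of the loss, so the risk of delta_psi is
   2 E[W(Z_1 - psi(D + lam))].

   W is even and convex; with v the positive part of its derivative,
     W(Z_1) - W(Z_1 - psi) = int_0^psi (v(Z_1 - c) - v(c - Z_1)) dc,
   and by Tonelli it suffices, for each level c, to compare
   E[v(Z_1 - c); D <= t] with E[v(c - Z_1); D <= t] on the sublevel sets of D
   on which c < psi(D + lam). The hypothesis is this comparison at c = psi(t).
   Reflecting turns the second expectation into E[v(Z_2 + c); D <= t], and the
   sign of v(Z_1 - c) - v(Z_2 + c) changes only once as D grows. In case (a)
   the comparison is therefore inherited by smaller t and c. In case (b) the
   hypothesis at t <= 0 forces the two sides to agree almost everywhere, and
   exchanging Z_1 and Z_2 transfers this to D > 0. *)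
Require Import Defs.
From HB Require Import structures.
From mathcomp Require Import all_boot all_order all_algebra.
From mathcomp Require Import all_classical all_reals all_analysis.
From mathcomp Require Import measurable_realfun.
From mathcomp Require Import lra ring.
Set Implicit Arguments. Unset Strict Implicit. Unset Printing Implicit Defensive.
Import Order.TTheory GRing.Theory Num.Theory.
Import numFieldNormedType.Exports.
Local Open Scope classical_set_scope.
Local Open Scope ring_scope.

(** * The fundamental theorem of calculus for absolutely continuous nondecreasing functions *)

Lemma derivable_near_addr (R : realType) (F G : R -> R) (c x : R) :
  derivable F x 1 -> (\forall t \near x, F t + c = G t) ->
  derivable G x 1 /\ derive1 G x = derive1 F x.
Proof.
move=> dF FG.
have dFc : derivable (F \+ cst c) x 1 by exact: derivableD.
split; first exact: near_eq_derivable FG dFc.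
by rewrite !derive1E -(near_eq_derive _ FG) deriveD// derive_cst addr0.
Qed.

Lemma lebesgue_stieltjes_measure_ocitv (R : realType) (F : cumulative R R)
    (x y : R) :
  x <= y -> lebesgue_stieltjes_measure F `]x, y]%classic = (F y - F x)%:E.
Proof.
move=> xy; rewrite /lebesgue_stieltjes_measure /measure_extension/=.
by rewrite measurable_mu_extE/=; [rewrite wlength_itv_bnd|exact: is_ocitv].
Qed.

Section abs_continuous.
Context {R : realType}.
Implicit Types (a b : R) (G : R -> R).

Lemma abs_continuous_on_unif a b G : abs_continuous_on a b G ->
  forall e : R, 0 < e -> exists2 d : R, 0 < d &
   forall y z, a <= y -> y <= z -> z <= b -> z - y < d -> `|G z - G y| < e.
Proof.
move=> acG e e0; have [d d0 acd] := acG e e0; exists d => // y z ay yz zb zyd.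
have := acd 1%N (fun=> y) (fun=> z); rewrite !big_ord1; apply => //.
Qed.

Lemma abs_continuous_continuous (W : R -> R) : abs_continuous W -> continuous W.
Proof.
move=> acW x; apply/cvgrPdist_lt => e e0.
have [d d0 H] := abs_continuous_on_unif (acW (x - 1) (x + 1)) e0.
near=> y.
have : `|x - y| < d by near: y; apply: cvgr_dist_lt => //; exact: cvg_id.
have : `|x - y| < 1 by near: y; apply: cvgr_dist_lt => //; exact: cvg_id.
move=> /ltr_normlP[h1 h2] /ltr_normlP[h3 h4].
have [xy|yx] := lerP x y.
  by rewrite distrC; apply: H; lra.
by apply: H; lra.
Unshelve. all: by end_near. Qed.

Definition clamp a b (x : R) := Num.min (Num.max x a) b.

Lemma clamp_in a b x : a <= b -> a <= clamp a b x <= b.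
Proof.
by move=> ab; rewrite /clamp le_min ge_min ab lexx orbT le_max lexx orbT.
Qed.

Lemma clamp_id a b x : a <= x <= b -> clamp a b x = x.
Proof. by move=> /andP[ax xb]; rewrite /clamp max_l// min_l. Qed.

Lemma le_clamp a b x y : x <= y -> clamp a b x <= clamp a b y.
Proof.
move=> xy; rewrite /clamp le_min ge_min ge_max; apply/andP; split.
  by rewrite le_max xy/= le_max lexx orbT.
by rewrite ge_min lexx orbT.
Qed.

Lemma clamp_lip a b x y : x <= y -> clamp a b y - clamp a b x <= y - x.
Proof.
move=> xy; rewrite /clamp /Num.min /Num.max.
by case: (ltP x a) => ?; case: (ltP y a) => ?; repeat case: ltP => ?; lra.
Qed.


Let lebR : {measure set (measurableTypeR R) -> \bar R} := @lebesgue_measure R.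

Variables (a b : R) (G : R -> R).
Hypotheses (ab : a < b) (acG : abs_continuous_on a b G).
Hypothesis ndG : {in `[a, b] &, {homo G : x y / x <= y}}.

(** Extending [G] by constants outside [[a, b]] gives a nondecreasing continuous function on the
    whole line, as the construction of a Stieltjes measure requires. *)
Let Gc (x : R) := G (clamp a b x).

Let Gc_nd : {homo Gc : x y / x <= y}.
Proof.
move=> x y xy; apply: ndG; rewrite ?in_itv/= ?clamp_in ?(ltW ab)//.
exact: le_clamp.
Qed.

Let Gc_continuous : continuous Gc.
Proof.
move=> x; apply/cvgrPdist_lt => e e0.
have [d d0 H] := abs_continuous_on_unif acG e0.
have Hc (y z : R) : y <= z -> z - y < d -> `|Gc z - Gc y| < e.
  move=> yz zyd; apply: H => //.
  - by have /andP[] := clamp_in y (ltW ab).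
  - exact: le_clamp.
  - by have /andP[] := clamp_in z (ltW ab).
  - exact: le_lt_trans (clamp_lip _ _ yz) zyd.
near=> y.
have : `|x - y| < d by near: y; apply: cvgr_dist_lt => //; exact: cvg_id.
move=> /ltr_normlP[h1 h2].
have [xy|yx] := lerP x y.
  by rewrite distrC; apply: Hc; lra.
by apply: Hc; lra.
Unshelve. all: by end_near. Qed.

Let Gc_rc : right_continuous Gc.
Proof. by apply: right_continuousW; exact: Gc_continuous. Qed.


Let Gc_mixin := isCumulative.Build R _ R Gc Gc_nd Gc_rc.
Let Vc : cumulative R R := HB.pack Gc Gc_mixin.

Let mV : {measure set (measurableTypeR R) -> \bar R} :=
  lebesgue_stieltjes_measure Vc.

Let mV_itv (x y : R) : x <= y -> mV `]x, y]%classic = (Gc y - Gc x)%:E.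
Proof.
by move=> xy; exact: (lebesgue_stieltjes_measure_ocitv Vc xy).
Qed.

Let mV_open (eps : R) : 0 < eps -> exists2 d : R, 0 < d &
  forall U : set R, open U -> (lebR U < d%:E)%E ->
    (mV (U `&` `]a, b]%classic) <= eps%:E)%E.
Proof.
move=> eps0; have [d d0 Hd] := acG eps0; exists d => // U oU lU.
have mU : measurable (U : set (measurableTypeR R)) by exact: open_measurable.
(* Dominate [U] from inside by the cells of uniform grids contained in it: for
   each grid these cells are a sorted finite family, as absolute continuity
   requires, and every point of [U] lies in such a cell of all fine grids. *)
pose p n i : R := a + i%:R * ((b - a) / n.+1%:R).
have h0 n : 0 < (b - a) / n.+1%:R by rewrite divr_gt0// subr_gt0.
have pS n i : p n i.+1 = p n i + (b - a) / n.+1%:R.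
  by rewrite /p -natr1 mulrDl mul1r addrA.
have p0 n : p n 0 = a by rewrite /p mul0r addr0.
have pn n : p n n.+1 = b by rewrite /p mulrCA divff ?pnatr_eq0// mulr1 subrKC.
have pm n i j : (i <= j)%N -> p n i <= p n j.
  by move=> ij; rewrite /p lerD2l ler_wpM2r ?ler_nat// ltW.
(* A cell not contained in [U] is collapsed to the empty interval []p n i, p n i]] rather than
   dropped, so that the family keeps its index set and its order. *)
pose q n i : R := if `[< `]p n i, p n i.+1]%classic `<=` U >]
  then p n i.+1 else p n i.
have pq n i : p n i <= q n i by rewrite /q; case: ifP => // _; exact: pm.
have qp n i : q n i <= p n i.+1 by rewrite /q; case: ifP => // _; exact: pm.
pose I n i : set (measurableTypeR R) := `]p n i, q n i]%classic.
have mI n i : measurable (I n i) by exact: measurable_itv.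
pose E n := \big[setU/set0]_(i < n.+1) I n i.
have mE n : measurable (E n) by apply: bigsetU_measurable => i _.
have qU n i : I n i `<=` U.
  rewrite /I /q; case: ifPn => [/asboolP//|_].
  by rewrite set_itv_ge// bnd_simp ltxx.
have EU n : E n `<=` U.
  by rewrite /E; elim/big_ind: _ => // A B AU BU x [/AU|/BU].
have tE n : trivIset [set: nat] (I n).
  apply/trivIsetP => /= i j _ _.
  wlog : i j / (i < j)%N.
    move=> wl; rewrite neq_lt => /orP[ij|ji]; first by apply: wl; rewrite ?lt_eqF.
    by rewrite setIC; apply: wl; rewrite ?lt_eqF.
  move=> ij _; apply/seteqP; split => // x/= []; rewrite /I/= !in_itv/=.
  move=> /andP[_ xq] /andP[px _].
  by have := pm n _ _ ij; have := qp n i; lra.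
have lE n : lebR (E n) = (\sum_(i < n.+1) (q n i - p n i))%:E.
  rewrite /E (measure_bigsetU lebR (mI n) (tE n)).
  rewrite -sumEFin; apply: eq_bigr => i _.
  rewrite /lebR [LHS]lebesgue_measure_itv/= lte_fin.
  have := pq n i; rewrite le_eqVlt => /orP[/eqP <-|->]; last by rewrite EFinB.
  by rewrite ltxx subrr.
have VE n : (mV (E n) <= eps%:E)%E.
  rewrite /E (measure_bigsetU mV (mI n) (tE n)).
  rewrite (eq_bigr (fun i : 'I_n.+1 => (Gc (q n i) - Gc (p n i))%:E)); last first.
    by move=> i _; exact: mV_itv.
  rewrite sumEFin lee_fin ltW//.
  have pab i : (i <= n.+1)%N -> a <= p n i <= b.
    by move=> iN; have := pm n _ _ (leq0n i); have := pm n _ _ iN; rewrite p0 pn => -> ->.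
  have qab i : (i < n.+1)%N -> a <= q n i <= b.
    move=> iN; have := pab i (ltnW iN); have := pab _ iN.
    by rewrite /q; case: ifP.
  have := Hd n.+1 (p n) (q n); rewrite (_ : \sum_(i < _) `|_| =
     \sum_(i < n.+1) (Gc (q n i) - Gc (p n i))); last first.
    apply: eq_bigr => i _; rewrite /Gc !clamp_id ?pab ?qab//; last exact: ltnW.
    rewrite ger0_norm// subr_ge0 ndG// in_itv/= ?pab ?qab//; exact: ltnW.
  apply.
  - move=> i iN; have /andP[? _] := pab i (ltnW iN).
    by have /andP[_ ?] := qab i iN.
  - by move=> i _; exact: qp.
  - rewrite -lte_fin -lE (le_lt_trans _ lU)// le_measure ?inE//; exact: EU.
(* The grids are not nested, so [E n] need not increase with [n]; the tail intersections [F n] do,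
   and continuity from below applies to them. *)
pose F n := \bigcap_(m >= n) E m.
have mF n : measurable (F n) by apply: bigcap_measurable => //; exists n => //=.
have ndF : nondecreasing_seq F.
  apply/nondecreasing_seqP => n; apply/subsetPset => x Fx m/= nm.
  by apply: Fx => /=; exact: ltnW.
have UF : U `&` `]a, b]%classic `<=` \bigcup_n F n.
  move=> x [Ux]; rewrite /= in_itv/= => /andP[ax xb].
  have /nbhs_ballP[r /= r0 rU] : nbhs x U by exact: open_nbhs_nbhs.
  have : \forall n \near \oo, (b - a) / n.+1%:R < r.
    have : ((b - a) * (n.+1%:R)^-1) @[n --> \oo] --> (b - a) * 0.
      by apply: cvgMl_tmp; exact: cvg_harmonic.
    rewrite mulr0 => /cvgrPdist_lt/(_ _ r0).
    apply: filterS => n; rewrite sub0r normrN; apply: le_lt_trans.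
    exact: ler_norm.
  move=> [n0 _ Hn]; exists n0 => // m/= nm.
  have {}Hn : (b - a) / m.+1%:R < r by exact: Hn.
  (* The least grid point not below [x] is the right end of the cell of [x]; the mesh is below [r],
     so this cell lies in the ball around [x] contained in [U]. *)
  have [i [iN pi ip]] : exists i, [/\ (i < m.+1)%N, p m i < x & x <= p m i.+1].
    have ex : exists i, x <= p m i by exists m.+1; rewrite pn.
    case: (ex_minnP ex) => -[|j] xj jmin.
      by move: xj; rewrite p0 leNgt ax.
    exists j; split => //; first by apply: jmin; rewrite pn.
    by rewrite ltNge; apply/negP => /jmin; rewrite ltnn.
  apply: (bigsetU_sup iN); rewrite /I/= in_itv/= pi/= /q ifT//.
  apply/asboolP => y/=; rewrite in_itv/= => /andP[py yp]; apply: rU.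
  rewrite /ball/= ltr_norml; move: ip yp; rewrite pS => ip yp.
  by move: ((b - a) / m.+1%:R) Hn ip yp => h; lra.
have mUab : measurable (U `&` `]a, b]%classic : set (measurableTypeR R)).
  by apply: measurableI.
apply: (@le_trans _ _ (mV (\bigcup_n F n))).
  rewrite le_measure ?inE//; exact: bigcupT_measurable.
have cvF := @nondecreasing_cvg_mu _ _ _ mV _ mF (bigcupT_measurable _ mF) ndF.
rewrite -(cvg_lim _ cvF)//; apply: lime_le; first exact: cvgP cvF.
apply: nearW => n /=; apply: le_trans (VE n).
rewrite le_measure ?inE// => x; apply => /=.
exact: leqnn.
Qed.


Let mV_fin : (mV `]a, b]%classic < +oo)%E.
Proof. by rewrite mV_itv ?ltW// ltry. Qed.

Let mab : measurable (`]a, b]%classic : set (measurableTypeR R)).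
Proof. exact: measurable_itv. Qed.

Let nu : {finite_measure set (measurableTypeR R) -> \bar R} :=
  mfrestr mab mV_fin.

Let nuE A : nu A = mV (A `&` `]a, b]%classic). Proof. by []. Qed.

(** Outer regularity encloses a null set in an open set of arbitrarily small Lebesgue measure, and
    [mV_open] bounds the Stieltjes measure of that open set. *)
Let mV_dominated : nu `<< @lebesgue_measure R.
Proof.
apply/null_content_dominatesP => A mA A0; rewrite nuE.
apply/eqP; rewrite eq_le measure_ge0 andbT.
apply/lee_addgt0Pr => e e0; rewrite add0e.
have [d d0 Hd] := mV_open e0.
have Afin : (@lebesgue_measure R A < +oo)%E by rewrite A0.
have [U [oU AU UA]] := lebesgue_regularity_outer mA Afin d0.
have mU : measurable (U : set (measurableTypeR R)).
  exact: open_measurable.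
apply: le_trans (Hd U oU _).
  by rewrite le_measure ?inE//; [exact: measurableI|exact: measurableI|exact: setSI].
apply: le_lt_trans UA; rewrite -{1}(setDUK AU).
have mUA : measurable (U `\` A : set (measurableTypeR R)) by exact: measurableD.
apply: le_trans (measureU2 _ mA mUA) _.
rewrite -[leRHS]add0e; apply: leeD => //.
by rewrite le_eqVlt; apply/orP; left; apply/eqP; exact: A0.
Qed.

(** The density [h] is the Radon-Nikodym derivative of the Stieltjes measure of [G]; differentiating
    its integral identifies it with the derivative of [G] almost everywhere. *)
Lemma abs_continuous_nondecreasing_ftc : exists h : R -> R, [/\ forall x, 0 <= h x,
  measurable_fun setT h,
  forall x y, a <= x -> x <= y -> y <= b ->
   (\int[@lebesgue_measure R]_(t in `[x, y]) (h t)%:E = (G y - G x)%:E)%E &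
  {ae @lebesgue_measure R, forall x, a < x < b ->
    derivable G x 1 /\ derive1 G x = h x}].
Proof.
have [h [h0 hfin hint hE]] := radon_nikodym_sigma_finite mV_dominated.
have [hr hrE] : exists hr, h = EFin \o hr.
  by exists (fine \o h); apply/funext => x /=; rewrite fineK.
subst h.
have mh : measurable_fun setT hr by apply/measurable_EFinP; exact: measurable_int hint.
have hEoc x y : a <= x -> x <= y -> y <= b ->
    (\int[@lebesgue_measure R]_(t in `]x, y]) (hr t)%:E = (G y - G x)%:E)%E.
  move=> ax xy yb; transitivity (nu `]x, y]%classic).
    by rewrite hE//; exact: measurable_itv.
  rewrite nuE setIidl; last first.
    move=> t; rewrite /= !in_itv/= => /andP[xt ty].
    by rewrite (le_lt_trans ax xt) (le_trans ty yb).
  rewrite mV_itv// /Gc !clamp_id//; first by rewrite ax (le_trans xy yb).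
  by rewrite (le_trans ax xy).
exists hr; split => //.
- move=> x y ax xy yb; rewrite -integral_itv_obnd_cbnd ?hEoc//.
  exact/measurable_EFinP/measurable_funTS.
- have ihr A : measurable A -> lebesgue_measure.-integrable A (EFin \o hr).
    by move=> mA; apply: integrableS hint.
  have iny (y : R) : lebesgue_measure.-integrable `]-oo, y] (EFin \o hr).
    by apply: ihr; exact: measurable_itv.
  have iloc : locally_integrable setT hr.
    by apply: open_integrable_locally; [exact: openT|exact: ihr].
  have := FTC1Ny iny iloc; apply: filterS.
    exact: (ae_filter_ringOfSetsType lebesgue_measure).
  move=> x [dF F'] axb.
  (* [nu] is carried by []a, b]], so for [t] inside the interval the integral of [hr] from minus
     infinity up to [t] is [G t - G a]. *)
  have near_eq : \forall t \near x,
    \int[lebesgue_measure]_(s in `]-oo, t]) hr s + G a = G t.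
    near=> t.
    have : t \in `]a, b[ by near: t; exact: near_in_itvoo.
    rewrite in_itv/= => /andP[a_t tb].
    rewrite /Rintegral (_ : integral _ _ _ = nu `]-oo, t]%classic); last first.
      by rewrite hE//; exact: measurable_itv.
    rewrite nuE (_ : _ `&` _ = `]a, t]%classic); last first.
      apply/seteqP; split => s /=; rewrite !in_itv/=; first by move=> [-> /andP[->]].
      by move=> /andP[-> st]; split => //; rewrite (le_trans st)// ltW.
    rewrite mV_itv ?ltW//= /Gc !clamp_id ?lexx ?(ltW ab)// ?subrK//.
    by rewrite (ltW a_t) ltW.
  by have [? ->] := derivable_near_addr dF near_eq.
Unshelve. all: by end_near. Qed.

End abs_continuous.

(** * The positive part of the derivative of the loss *)

Lemma negligible_oppr (R : realType) (N : set R) :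
  (@lebesgue_measure R).-negligible N ->
  (@lebesgue_measure R).-negligible (-%R @^-1` N).
Proof.
move=> [A [mA A0 NA]]; exists (-%R @^-1` A); split => //.
- rewrite -[X in measurable X]setTI; exact: oppr_measurable.
- by rewrite -A0; exact: lebesgue_measureN.
- by move=> x /NA.
Qed.

Lemma negligible_itv_nonempty (R : realType) (N : set R) (a b : R) :
  a < b -> (@lebesgue_measure R).-negligible N ->
  exists2 y, a < y <= b & ~ N y.
Proof.
move=> ab [A [mA A0 NA]]; apply: contrapT => /forall2NP H.
have sA : `]a, b]%classic `<=` A.
  move=> y /= yab; apply: NA; have [|/contrapT//] := H y.
  by move: yab; rewrite in_itv/=.
have : (@lebesgue_measure R `]a, b]%classic <= lebesgue_measure A)%E.
  by rewrite le_measure ?inE//; exact: measurable_itv.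
rewrite [leRHS]A0 lebesgue_measure_itv/= lte_fin ab -EFinD lee_fin.
by rewrite leNgt subr_gt0 ab.
Qed.

Lemma derive1_even (R : realType) (W : R -> R) (x : R) :
  (forall t, W t = W (- t)) -> derivable W (- x) 1 ->
  derive1 W x = - derive1 W (- x).
Proof.
move=> We dW; rewrite {1}(funext We : W = W \o -%R).
have dN : is_derive x (1 : R) (-%R : R -> R) (- 1).
  by apply: is_deriveN; exact: is_derive_id.
have eN : derive1 (-%R : R -> R) x = - 1 by rewrite derive1E; exact: derive_val.
have dn : derivable (-%R : R -> R) x 1 by exact: ex_derive.
rewrite (derive1_comp dn dW) eN.
by rewrite mulrN1.
Qed.

Section loss_slope.
Context {R : realType}.
Variable W : R -> R.
Hypothesis hW_ge0 : forall t : R, 0 <= W t.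
Hypothesis hW_ac : abs_continuous W.
Hypothesis hW0 : W 0 = 0.
Hypothesis hW_even : forall t : R, W t = W (- t).
Hypothesis hW_inc : {in `]0, +oo[ &, forall x y : R, x < y -> W x < W y}.
Hypothesis hW'_inc : exists N : set R, (@lebesgue_measure R).-negligible N /\
       {in ~` N &, forall x y : R, x <= y -> derive1 W x <= derive1 W y}.

Let W_nd x y : 0 <= x -> x <= y -> W x <= W y.
Proof.
rewrite le_eqVlt => /orP[/eqP <-|x0]; first by rewrite hW0 hW_ge0.
rewrite le_eqVlt => /orP[/eqP <-//|xy].
by apply/ltW/hW_inc => //; rewrite in_itv/= andbT// (lt_trans x0).
Qed.

(** On the positive half-line [v] agrees almost everywhere with the densities that the calculus
    theorem gives on the intervals [[0, n + 1]], hence integrates to the increments of [W]. Evenness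
    of [W] makes its derivative odd, which yields the last clause on the negative half-line. *)
Lemma loss_slope : exists v : R -> R, [/\ forall x, 0 <= v x,
  {homo v : x y / x <= y}, forall x, x <= 0 -> v x = 0,
  forall a b, 0 <= a -> a <= b ->
    (\int[@lebesgue_measure R]_(t in `[a, b]) (v t)%:E = (W b - W a)%:E)%E &
  (@lebesgue_measure R).-negligible
    [set x | derive1 W x <> v x - v (- x)]].
Proof.
have [N [N0 NW]] := hW'_inc.
have ftc n : exists h : R -> R, [/\ forall x, 0 <= h x,
  measurable_fun setT h,
  forall x y, 0 <= x -> x <= y -> y <= n.+1%:R ->
   (\int[@lebesgue_measure R]_(t in `[x, y]) (h t)%:E = (W y - W x)%:E)%E &
  {ae @lebesgue_measure R, forall x, 0 < x < n.+1%:R ->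
    derivable W x 1 /\ derive1 W x = h x}].
  apply: abs_continuous_nondecreasing_ftc; [by rewrite ltr0n|exact: hW_ac|].
  by move=> x y; rewrite !in_itv/= => /andP[x0 _] _; exact: W_nd.
have [h hP] := choice ftc.
pose N1 := \bigcup_n [set x | ~ (0 < x < n.+1%:R ->
  derivable W x 1 /\ derive1 W x = h n x)].
have N10 : (@lebesgue_measure R).-negligible N1.
  by apply: negligible_bigcup => n; have [_ _ _] := hP n.
have N1P x n : ~ N1 x -> 0 < x < n.+1%:R ->
    derivable W x 1 /\ derive1 W x = h n x.
  by move=> nx xn; apply: contrapT => H; apply: nx; exists n => //= /(_ xn).
have ubn (x : R) : exists n : nat, x < n.+1%:R.
  exists (Num.bound x); rewrite (lt_le_trans (unstable.ltr_bound x))//.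
  by rewrite ler_nat.
have N1P' x : ~ N1 x -> 0 < x -> derivable W x 1 /\ 0 <= derive1 W x.
  move=> nx x0; have [n xn] := ubn x.
  have [dW ->] := N1P x n nx (introT andP (conj x0 xn)).
  by split=> //; have [+ _ _ _] := hP n; exact.
(* Off [N] the derivative is monotone; at positive points off [N1] it exists and equals the
   densities, so it is nonnegative there. *)
pose M := N `|` N1.
have M0 : (@lebesgue_measure R).-negligible M by exact: negligibleU.
pose S x := [set derive1 W y | y in [set y | ~ M y /\ 0 < y <= x]].
have S0 x : 0 < x -> S x !=set0.
  move=> x0; have [y y0x My] := negligible_itv_nonempty x0 M0.
  by exists (derive1 W y); exists y.
have mono x y : ~ M x -> ~ M y -> x <= y -> derive1 W x <= derive1 W y.
  by move=> Mx My; apply: NW; rewrite inE => ?; [apply: Mx|apply: My]; left.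
have Sub x : has_ubound (S x).
  have xx1 : x < x + 1 by rewrite ltrDl.
  have [y /andP[xy _] My] := negligible_itv_nonempty xx1 M0.
  exists (derive1 W y) => _ [z [Mz /andP[z0 zx]] <-].
  by apply: mono => //; rewrite (le_trans zx)// ltW.
(* The monotone extension of [derive1 W] from the complement of [M]; unlike
   [derive1 W] itself it is visibly measurable. *)
pose v x := if 0 < x then sup (S x) else 0.
have vE x : ~ M x -> 0 < x -> v x = derive1 W x.
  move=> Mx x0; rewrite /v x0; apply/eqP; rewrite eq_le; apply/andP; split.
    apply: ge_sup; first exact: S0.
    by move=> _ [z [Mz /andP[z0 zx]] <-]; exact: mono.
  by apply: ub_le_sup; [exact: Sub|exists x => //=; split => //; rewrite x0 lexx].
have v0 x : 0 <= v x.
  rewrite /v; case: ifPn => // x0; have [_ [y yS _]] := S0 _ x0.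
  apply: (@le_trans _ _ (derive1 W y)); last by apply: ub_le_sup => //; exists y.
  have [My /andP[y0 _]] := yS.
  by have [|] := N1P' y _ y0 => //; move=> ?; apply: My; right.
have vnd : {homo v : x y / x <= y}.
  move=> x y xy; rewrite {1}/v; case: ifPn => // x0.
  have y0 := lt_le_trans x0 xy; rewrite /v y0; apply: ge_sup; first exact: S0.
  move=> _ [z [Mz /andP[z0 zx]] <-]; apply: ub_le_sup; first exact: Sub.
  by exists z => //; split => //; rewrite z0 (le_trans zx).
have vneg x : x <= 0 -> v x = 0 by rewrite /v ltNge => ->.
have mv : measurable_fun setT v by exact: nondecreasing_measurable.
exists v; split => //.
- move=> a b a0 ab; have [n bn] := ubn b.
  have [h0 mh hE _] := hP n; rewrite -hE ?(ltW bn)//.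
  rewrite -integral_itv_obnd_cbnd; last exact/measurable_EFinP/measurable_funTS.
  rewrite -[RHS]integral_itv_obnd_cbnd; last exact/measurable_EFinP/measurable_funTS.
  apply: ge0_ae_eq_integral => //.
  + exact/measurable_EFinP/measurable_funTS.
  + exact/measurable_EFinP/measurable_funTS.
  + by move=> x _; rewrite lee_fin.
  + by move=> x _; rewrite lee_fin.
  + have [A [mA A0 MA]] := M0; exists A; split => // x /=; apply: contra_notP => Ax.
    rewrite in_itv/= => /andP[ax xb]; congr EFin.
    have Mx : ~ M x by move=> /MA.
    have x0 := le_lt_trans a0 ax.
    rewrite vE//; have [| |//] := N1P x n.
      by move=> ?; apply: Mx; right.
    by rewrite x0 (le_lt_trans xb).
(* A negative [x] is handled through [- x], so the exceptional set is made symmetric; the origin is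
   added because the split by sign leaves it out. *)
- have : (@lebesgue_measure R).-negligible (M `|` -%R @^-1` M `|` [set 0]).
    apply: negligibleU; first by apply: negligibleU => //; exact: negligible_oppr.
    by exists [set 0]; split => //; exact: lebesgue_measure_set1.
  move=> [A [mA A0 MA]]; exists A; split => // x /=.
  rewrite -[A x]not_notE; apply: contra_not => /(contra_not (@MA x)).
  move=> /not_orP[/not_orP[Mx MNx] xn0].
  have [x0|x0|//] := ltgtP x 0; last first.
    by rewrite (vneg (- x)) ?subr0 ?vE// oppr_le0 ltW.
  rewrite vneg ?(ltW x0)// sub0r vE ?oppr_gt0//.
  have [| |? _] := N1P' (- x); last exact: derive1_even.
    by move=> ?; apply: MNx; right.
  by rewrite oppr_gt0.
Qed.
End loss_slope.

(** * Invariance of Lebesgue measure on the line and in the plane *)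

Section leb2_invariance.
Context {R : realType}.
Local Open Scope ereal_scope.
Local Notation mu := (@lebesgue_measure R).

Let ge0_integral_measure_preserving
    (phi : measurableTypeR R -> measurableTypeR R) (g : R -> \bar R) :
  measurable_fun setT phi ->
  (forall A, measurable A -> pushforward mu phi A = mu A) ->
  measurable_fun setT g -> (forall x, 0 <= g x) ->
  \int[mu]_x g (phi x) = \int[mu]_x g x.
Proof.
move=> mphi muphi mg g0; transitivity (\int[pushforward mu phi]_x g x).
  by apply/esym; apply: (ge0_integral_pushforward mphi).
pose phi' : {mfun measurableTypeR R >-> measurableTypeR R} :=
  HB.pack phi (isMeasurableFun.Build _ _ _ _ phi mphi).
apply: (@eq_measure_integral _ _ _ setT mu (pushforward mu phi')) => A mA _.
exact: muphi.
Qed.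

Lemma ge0_integral_oppr (g : R -> \bar R) :
  measurable_fun setT g -> (forall x, 0 <= g x) ->
  \int[mu]_x g (- x)%R = \int[mu]_x g x.
Proof.
apply: (ge0_integral_measure_preserving (phi := -%R)).
  exact: oppr_measurable.
by move=> A mA; exact: lebesgue_measureN.
Qed.

Lemma measurable_shift (c : R) :
  measurable_fun setT ((fun x => x + c)%R : measurableTypeR R -> measurableTypeR R).
Proof. by apply: (measurable_funD (f := id)) => //; exact: measurable_id. Qed.

Lemma lebesgue_measure_shift (c : R) (A : set (measurableTypeR R)) :
  measurable A ->
  pushforward mu ((fun x => x + c)%R : measurableTypeR R -> measurableTypeR R) A =
  mu A.
Proof.
move=> mA.
pose mf : {mfun measurableTypeR R >-> measurableTypeR R} :=
  HB.pack ((fun x => x + c)%R : measurableTypeR R -> measurableTypeR R)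
    (isMeasurableFun.Build _ _ _ _
       ((fun x => x + c)%R : measurableTypeR R -> measurableTypeR R)
       (measurable_shift c)).
apply/esym.
apply: (lebesgue_measure_unique (mu := pushforward mu mf)) => //= _ [[a b]] _ <-.
rewrite /pushforward/= (_ : _ @^-1` _ = `]a - c, b - c]%classic)%R; last first.
  by apply/seteqP; split => x /=; rewrite !in_itv/= ltrBlDr lerBrDr.
rewrite [LHS]lebesgue_measure_itv [RHS]lebesgue_measure_itv/= !lte_fin.
rewrite ltrD2r; case: ifP => // _; rewrite -!EFinD; congr EFin.
by rewrite opprD addrACA subrr addr0.
Qed.

Lemma ge0_integral_shift (c : R) (g : R -> \bar R) :
  measurable_fun setT g -> (forall x, 0 <= g x) ->
  \int[mu]_x g (x + c)%R = \int[mu]_x g x.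
Proof.
apply: (ge0_integral_measure_preserving (phi := fun x => x + c)%R).
  exact: measurable_shift.
by move=> A mA; exact: lebesgue_measure_shift.
Qed.

Variable g : R * R -> \bar R.
Hypothesis mg : measurable_fun setT g.
Hypothesis g0 : forall z, 0 <= g z.

Lemma leb2_tonelli : \int[@leb2 R]_z g z = \int[mu]_x \int[mu]_y g (x, y).
Proof. exact: fubini_tonelli1. Qed.

End leb2_invariance.

Section leb2_maps.
Context {R : realType}.
Local Open Scope ereal_scope.
Local Notation mu := (@lebesgue_measure R).
Variable g : R * R -> \bar R.
Hypothesis mg : measurable_fun setT g.
Hypothesis g0 : forall z, 0 <= g z.

Lemma leb2_swap : \int[@leb2 R]_z g (z.2, z.1) = \int[@leb2 R]_z g z.
Proof.
have mg' : measurable_fun setT (fun z : R * R => g (z.2, z.1)).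
  apply: (measurableT_comp mg (g := fun z : R * R => (z.2, z.1))).
  by apply: measurable_fun_pair; [exact: measurable_snd|exact: measurable_fst].
rewrite !leb2_tonelli//=.
by rewrite [RHS](fubini_tonelli (m1 := mu) (m2 := mu)).
Qed.

Lemma leb2_shift (a b : R) :
  \int[@leb2 R]_z g (z.1 + a, z.2 + b)%R = \int[@leb2 R]_z g z.
Proof.
have ms : measurable_fun setT (fun z : R * R => (z.1 + a, z.2 + b)%R).
  apply: measurable_fun_pair.
    by apply: measurable_funD => //; exact: measurable_fst.
  by apply: measurable_funD => //; exact: measurable_snd.
have mg' : measurable_fun setT (fun z : R * R => g (z.1 + a, z.2 + b)%R).
  exact: measurableT_comp mg ms.
rewrite !leb2_tonelli//=.
rewrite -[RHS](ge0_integral_shift a); last 2 first.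
- exact: (measurable_fun_fubini_tonelli_F (m2 := mu)).
- by move=> x; exact: integral_ge0.
apply: eq_integral => x _; apply: (ge0_integral_shift b (g := fun y => g (x + a, y)%R)) => //.
exact: measurable_fun_pair2.
Qed.

Lemma leb2_oppr : \int[@leb2 R]_z g (- z.1, - z.2)%R = \int[@leb2 R]_z g z.
Proof.
have ms : measurable_fun setT (fun z : R * R => (- z.1, - z.2)%R).
  apply: measurable_fun_pair.
    by apply: measurableT_comp; [exact: oppr_measurable|exact: measurable_fst].
  by apply: measurableT_comp; [exact: oppr_measurable|exact: measurable_snd].
have mg' : measurable_fun setT (fun z : R * R => g (- z.1, - z.2)%R).
  exact: measurableT_comp mg ms.
rewrite !leb2_tonelli//=.
rewrite -[RHS]ge0_integral_oppr; last 2 first.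
- exact: (measurable_fun_fubini_tonelli_F (m2 := mu)).
- by move=> x; exact: integral_ge0.
apply: eq_integral => x _; apply: (ge0_integral_oppr (g := fun y => g (- x, y)%R)) => //.
exact: measurable_fun_pair2.
Qed.
End leb2_maps.

Section leb2_sigma_finite.
Context {R : realType}.
Local Open Scope ereal_scope.
Local Notation mu := (@lebesgue_measure R).

Lemma leb2_sigma_finite : sigma_finite [set: measurableTypeR R * measurableTypeR R] (@leb2 R).
Proof.
have /sigma_finiteP[F [TF ndF Foo]] := @sigma_finiteT _ _ _ mu.
exists (fun n => F n `*` F n).
  rewrite -setXTT TF predeqE => -[x y]; split.
    move=> [/= [n _ Fnx] [k _ Fky]]; exists (maxn n k) => //; split.
      by move: x Fnx; exact/subsetPset/ndF/leq_maxl.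
    by move: y Fky; exact/subsetPset/ndF/leq_maxr.
  by move=> [n _ []/= ? ?]; split; exists n.
move=> k; have [mFk Fkoo] := Foo k.
split; first exact: measurableX.
by rewrite /leb2 product_measure1E// lte_mul_pinfty// ge0_fin_numE.
Qed.

(** Packages the plane measure so that Tonelli applies to the product of the line of levels with the
    plane. *)
Definition sigma_finite_leb2 :
    {sigma_finite_measure set (measurableTypeR R * measurableTypeR R)%type -> \bar R} :=
  HB.pack (mu \x mu)
    (@Measure_isSigmaFinite.Build _ _ _ (mu \x mu) leb2_sigma_finite).
End leb2_sigma_finite.

(** * Integrals over the plane with weight [f] *)

Section weighted.
Context {R : realType}.
Local Open Scope ereal_scope.
Variable f : R * R -> R.
Hypothesis mf : measurable_fun setT f.
Hypothesis f0 : forall z, (0 <= f z)%R.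
Implicit Types (A E F : set (R * R)) (phi chi : R * R -> R).

(** For [f] the density of [Z] this is the expectation of [phi] at [Z] over the event [A]; it may be
    infinite. *)
Definition wint A phi : \bar R := \int[@leb2 R]_(z in A) (phi z * f z)%:E.

Let mphif A phi : measurable_fun setT phi ->
  measurable_fun A (fun z => (phi z * f z)%:E).
Proof.
by move=> mphi; apply/measurable_funTS/measurable_EFinP/measurable_funM.
Qed.

Lemma wint_ge0 A phi : (forall z, 0 <= phi z)%R -> 0 <= wint A phi.
Proof. by move=> p0; apply: integral_ge0 => z _; rewrite lee_fin mulr_ge0. Qed.

Lemma le_wint A phi chi : measurable A ->
  measurable_fun setT phi -> measurable_fun setT chi ->
  (forall z, 0 <= phi z)%R -> (forall z, A z -> phi z <= chi z)%R ->
  wint A phi <= wint A chi.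
Proof.
move=> mA mp mc p0 pc; apply: ge0_le_integral => //.
- by move=> z _; rewrite lee_fin mulr_ge0.
- exact: mphif.
- exact: mphif.
- by move=> z Az; rewrite lee_fin ler_wpM2r// pc.
Qed.

Lemma wint_setD E F phi : measurable E -> measurable F -> E `<=` F ->
  measurable_fun setT phi -> (forall z, 0 <= phi z)%R ->
  wint F phi = wint E phi + wint (F `\` E) phi.
Proof.
move=> mE mF EF mp p0; rewrite -{1}(setDUK EF).
rewrite /wint ge0_integral_setU//.
- exact: measurableD.
- exact: mphif.
- by move=> z _; rewrite lee_fin mulr_ge0.
- by apply/disj_setPS => z [? []].
Qed.

(** Both integrals over [F] split over [E] and the remainder. On the remainder the integrands are
    ordered the other way, so [chi] may be replaced there by [phi], and the finite common term
    cancels. *)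
Lemma wint_cancel E F phi chi : measurable E -> measurable F -> E `<=` F ->
  measurable_fun setT phi -> measurable_fun setT chi ->
  (forall z, 0 <= phi z)%R -> (forall z, 0 <= chi z)%R ->
  (forall z, (F `\` E) z -> chi z <= phi z)%R ->
  wint F phi <= wint F chi -> wint (F `\` E) phi < +oo ->
  wint E phi <= wint E chi.
Proof.
move=> mE mF EF mp mc p0 c0 cp; rewrite !(wint_setD mE mF EF)//.
move=> le fin; rewrite -(@leeD2rE _ (wint (F `\` E) phi)); last first.
  by rewrite ge0_fin_numE//; exact: wint_ge0.
apply: le_trans le _; apply: leeD => //; apply: le_wint => //.
exact: measurableD.
Qed.

Lemma wint_map (S : R * R -> R * R) A phi :
  measurable_fun setT S ->
  (forall g : R * R -> \bar R, measurable_fun setT g -> (forall z, 0 <= g z) ->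
    \int[@leb2 R]_z g (S z) = \int[@leb2 R]_z g z) ->
  (forall z, f (S z) = f z) -> measurable A ->
  measurable_fun setT phi -> (forall z, 0 <= phi z)%R ->
  wint (S @^-1` A) (phi \o S) = wint A phi.
Proof.
move=> mS Sint fS mA mp p0; rewrite /wint integral_mkcond [RHS]integral_mkcond.
rewrite -[RHS]Sint.
- by apply: eq_integral => z _; rewrite !patchE /= fS.
- exact: (measurable_restrictT (fun z => (phi z * f z)%:E) mA).1 (mphif mp).
- move=> z; rewrite patchE; case: ifPn => // _.
  by rewrite lee_fin mulr_ge0.
Qed.

End weighted.

(** In an unbounded down-set the naturals are cofinal. If the supremum is attained, a constant
    sequence serves; otherwise the sequence approaches the supremum from below at distance
    [1 / (n + 1)]. *)
Lemma downset_cofinal (R : realType) (S : set R) :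
  S !=set0 -> (forall u w, S u -> w <= u -> S w) ->
  exists s : nat -> R, [/\ nondecreasing_seq s, forall n, S (s n) &
    forall w, S w -> exists n, w <= s n].
Proof.
move=> [x0 Sx0] Sd; have [ubS|nubS] := pselect (has_ubound S); last first.
  exists (fun n => n%:R); split.
  - by move=> m n mn; rewrite ler_nat.
  - move=> n; apply: contrapT => Sn; apply: nubS; exists n%:R => w Sw.
    by rewrite leNgt; apply/negP => nw; apply: Sn; apply: Sd Sw (ltW nw).
  - move=> w _; exists (Num.bound w); exact/ltW/unstable.ltr_bound.
have [Sb|nSb] := pselect (S (sup S)).
  exists (fun=> sup S); split => // w Sw; exists 0%N.
  exact: ub_le_sup.
exists (fun n => sup S - n.+1%:R^-1); split.
- move=> m n mn; rewrite lerD2l lerN2 lef_pV2 ?posrE ?ltr0n//.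
  by rewrite ler_nat.
- move=> n; have e0 : (0 : R) < n.+1%:R^-1 by rewrite invr_gt0.
  have hS : has_sup S by split => //; exists x0.
  have [s Ss ss] := sup_adherent e0 hS.
  by apply: Sd Ss (ltW ss).
- move=> w Sw; have wS : w < sup S.
    rewrite lt_neqAle ub_le_sup// andbT; apply/eqP => wE.
    by apply: nSb; rewrite -wE.
  exists (Num.bound (sup S - w)^-1).
  have sw : 0 < sup S - w by rewrite subr_gt0.
  rewrite lerBrDr -lerBrDl -[leRHS]invrK lef_pV2 ?posrE ?ltr0n ?invr_gt0//.
  apply/ltW; apply: lt_le_trans (unstable.ltr_bound _) _; by rewrite ler_nat.
Qed.

(** Level sets of a monotone function can be open rays, while the comparison is known on closed
    ones; monotone convergence along an exhausting sequence of closed rays carries it over. *)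
Lemma wint_downset_le (R : realType) (f : R * R -> R) (d : R * R -> R)
    (S : set R) (phi chi : R * R -> R) :
  measurable_fun setT f -> (forall z, 0 <= f z) ->
  measurable_fun setT d ->
  (forall u w, S u -> w <= u -> S w) ->
  measurable_fun setT phi -> measurable_fun setT chi ->
  (forall z, 0 <= phi z) -> (forall z, 0 <= chi z) ->
  (forall u, S u -> (wint f [set z | (d z <= u)%R] phi <=
                     wint f [set z | (d z <= u)%R] chi)%E) ->
  (wint f [set z | S (d z)] phi <= wint f [set z | S (d z)] chi)%E.
Proof.
move=> mf f0 md Sd mp mc p0 c0 H.
have [S0|/set0P Sn0] := eqVneq S set0.
  by rewrite S0 /wint (_ : [set z | _] = set0)// !integral_set0.
have [s [nds Ss scof]] := downset_cofinal Sn0 Sd.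
have -> : [set z | S (d z)] = \bigcup_n [set z | d z <= s n].
  apply/seteqP; split => [z /= /scof[n] zn|z [n _ /= zn]]; first by exists n.
  exact: Sd zn.
have nd : nondecreasing_seq (fun n => [set z | d z <= s n]).
  by move=> m n mn; apply/subsetPset => z /= /le_trans; apply; exact: nds.
have md' n : measurable [set z | d z <= s n].
  rewrite (_ : [set z | _] = d @^-1` `]-oo, s n]%classic); last first.
    by apply/seteqP; split => z /=; rewrite in_itv.
  by rewrite -[X in measurable X]setTI; exact: md.
have cv (phi' : R * R -> R) : measurable_fun setT phi' -> (forall z, 0 <= phi' z) ->
    wint f [set z | d z <= s n] phi' @[n --> \oo] -->
    wint f (\bigcup_n [set z | d z <= s n]) phi'.
  move=> mp' p0'; apply: ge0_nondecreasing_set_cvg_integral => //.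
    by move=> n; apply/measurable_funTS/measurable_EFinP/measurable_funM.
  by move=> n z _; rewrite lee_fin mulr_ge0.
apply: (lee_cvg_to (cv phi mp p0) (cv chi mc c0)).
by apply: nearW => n; exact: H.
Qed.

(** * Comparing the shifted and the unshifted loss level by level *)

Section layer_cake.
Context {R : realType}.
Local Notation mu := (@lebesgue_measure R).
Variables (W v : R -> R).
Hypothesis W0 : W 0 = 0.
Hypothesis W_ge0 : forall t, 0 <= W t.
Hypothesis W_even : forall t, W t = W (- t).
Hypothesis mW : measurable_fun setT W.
Hypothesis v0 : forall x, 0 <= v x.
Hypothesis vnd : {homo v : x y / x <= y}.
Hypothesis vneg : forall x, x <= 0 -> v x = 0.
Hypothesis vW : forall a b, 0 <= a -> a <= b ->
  (\int[mu]_(t in `[a, b]) (v t)%:E = (W b - W a)%:E)%E.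

(** The right half of the loss, continued by [W 0 = 0] to the left. Since [v] vanishes there too,
    [Wp] is a primitive of [v] on the whole line, which avoids sign cases for the endpoints. *)
Let Wp x := W (Num.max x 0).

Let mv : measurable_fun setT v.
Proof. exact: nondecreasing_measurable. Qed.

Let mv_itv (i : interval R) :
  measurable_fun setT ((EFin \o v) \_ [set` i]).
Proof.
have mi : measurable [set` i] by exact: measurable_itv.
apply: (measurable_restrictT (EFin \o v) mi).1.
exact/measurable_funTS/measurable_EFinP.
Qed.

Lemma loss_split x : W x = Wp x + Wp (- x).
Proof.
rewrite /Wp; have [x0|x0] := leP x 0.
  by rewrite (max_l _ : Num.max (- x) 0 = - x) ?oppr_ge0// W0 add0r.
by rewrite (max_r _ : Num.max (- x) 0 = 0) ?oppr_le0 ?ltW// W0 addr0.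
Qed.

Let integral_slope a b : a <= b ->
  (\int[mu]_(t in `[a, b]) (v t)%:E = (Wp b - Wp a)%:E)%E.
Proof.
move=> ab; rewrite -vW; last 2 first.
- by rewrite le_max lexx orbT.
- by rewrite ge_max !le_max ab lexx orbT.
rewrite integral_mkcond [RHS]integral_mkcond; apply: eq_integral => t _.
have [t0|t0] := leP t 0; first by rewrite !patchE vneg// !if_same.
rewrite !patchE; congr (if _ then _ else _); apply/idP/idP; rewrite !inE/= !in_itv/=.
  by move=> /andP[ta tb]; rewrite ge_max ta (ltW t0) le_max tb.
rewrite ge_max le_max => /andP[/andP[-> _]] /orP[->//|].
by rewrite leNgt t0.
Qed.

Lemma integral_slope_left (e y : R) : 0 <= e ->
  (\int[mu]_(c in `[0%R, e[) (v (c - y))%:E = (Wp (e - y) - Wp (- y))%:E)%E.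
Proof.
move=> e0; rewrite -integral_slope; last by rewrite -[leLHS]add0r lerD2r.
rewrite -integral_itv_bndo_bndc; last exact/measurable_funTS/measurable_EFinP.
rewrite integral_mkcond [RHS]integral_mkcond.
rewrite -[RHS](ge0_integral_shift (- y)).
- apply: eq_integral => c _; rewrite !patchE; congr (if _ then _ else _).
  by apply/idP/idP; rewrite !inE/= !in_itv/= ltrD2r -{1}[- y]add0r lerD2r.
- exact: mv_itv.
- by move=> x; rewrite patchE; case: ifPn => // _; rewrite lee_fin.
Qed.

Lemma integral_slope_right (e y : R) : 0 <= e ->
  (\int[mu]_(c in `[0%R, e[) (v (y - c))%:E = (Wp y - Wp (y - e))%:E)%E.
Proof.
move=> e0; rewrite -integral_slope; last by rewrite gerBl.
rewrite -[RHS]integral_itv_obnd_cbnd; last exact/measurable_funTS/measurable_EFinP.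
have mr : measurable_fun setT ((EFin \o v) \_ `]y - e, y]%classic).
  exact: mv_itv.
have r0 x : (0 <= ((EFin \o v) \_ `](y - e)%R, y]%classic) x)%E.
  by rewrite patchE; case: ifPn => // _; rewrite lee_fin.
rewrite integral_mkcond [RHS]integral_mkcond.
rewrite -[RHS](ge0_integral_shift y)// -[RHS]ge0_integral_oppr//; last first.
  apply: measurableT_comp mr _; exact: measurable_shift.
apply: eq_integral => c _; rewrite !patchE [- c + y]addrC /=.
congr (if _ then _ else _).
by apply/idP/idP; rewrite !inE/= !in_itv/= ltrD2l ltrN2 gerBl andbC.
Qed.

Variables (f x : R * R -> R) (eta : R -> R) (lam : R).
Hypothesis mf : measurable_fun setT f.
Hypothesis f0 : forall z, 0 <= f z.
Hypothesis mx : measurable_fun setT x.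
Hypothesis eta0 : forall t, 0 <= eta t.
Hypothesis eta_ni : {homo eta : s t / s <= t >-> t <= s}.

Let d (z : R * R) := z.2 - z.1 + lam.
Let md : measurable_fun setT d.
Proof.
apply: measurable_funD => //; apply: measurable_funB.
  exact: measurable_snd.
exact: measurable_fst.
Qed.

Hypothesis le_v : forall c u, 0 <= c -> c < eta u ->
  (wint f [set z | (d z <= u)%R] (fun z => v (c - x z)) <=
   wint f [set z | (d z <= u)%R] (fun z => v (x z - c)))%E.

Let meta : measurable_fun setT eta.
Proof. exact: nonincreasing_measurable. Qed.

Let met : measurable_fun setT (fun z => eta (d z)).
Proof. exact: measurableT_comp meta md. Qed.

Section inner.
Variable g : R -> R * R -> R.
Hypothesis mg : measurable_fun setT (fun cz : R * (R * R) => g cz.1 cz.2).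
Hypothesis g0 : forall c z, 0 <= g c z.

(** The joint integrand in the level [c] and the point [z]. Integrating over [z] first gives the
    integral over one level set; integrating over [c] first gives the integral over the levels
    between 0 and the shift. *)
Let G (cz : R * (R * R)) : \bar R :=
  (if (0 <= cz.1) && (cz.1 < eta (d cz.2)) then g cz.1 cz.2 * f cz.2 else 0)%:E.

Let mG : measurable_fun setT G.
Proof.
apply/measurable_EFinP; apply: measurable_fun_ifT => //.
- apply: measurable_and.
    by apply: measurable_fun_ler => //; exact: measurable_fst.
  apply: measurable_fun_ltr; first exact: measurable_fst.
  exact: (measurableT_comp met measurable_snd).
- apply: measurable_funM => //; exact: (measurableT_comp mf measurable_snd).
Qed.

Let G0 cz : (0 <= G cz)%E.
Proof. by rewrite /G; case: ifP; rewrite lee_fin// mulr_ge0. Qed.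

Let GE c : 0 <= c ->
  (\int[@leb2 R]_z G (c, z) = wint f [set z | (c < eta (d z))%R] (g c))%E.
Proof.
move=> c0; rewrite /wint [RHS]integral_mkcond; apply: eq_integral => z _.
rewrite patchE /G/= c0/=; case: ifPn => [ce|/negP ce].
  by rewrite mem_set.
by rewrite memNset.
Qed.

Lemma measurable_level_wint :
  measurable_fun (`[0, +oo[%classic : set R)
    (fun c => wint f [set z | (c < eta (d z))%R] (g c)).
Proof.
apply: (eq_measurable_fun (fun c => \int[@leb2 R]_z G (c, z))%E).
  by move=> c; rewrite inE/= in_itv/= andbT => c0; exact: GE.
apply: measurable_funTS.
exact: (measurable_fun_fubini_tonelli_F (m2 := @sigma_finite_leb2 R)).
Qed.

Lemma integral_level_wint :
  (\int[mu]_(c in `[0%R, +oo[) wint f [set z | (c < eta (d z))%R] (g c) =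
   \int[@leb2 R]_z ((f z)%:E * \int[mu]_(c in `[0%R, eta (d z)[) (g c z)%:E))%E.
Proof.
transitivity (\int[mu]_c \int[@leb2 R]_z G (c, z))%E.
  rewrite integral_mkcond; apply: eq_integral => c _.
  rewrite patchE; case: ifPn; rewrite ?notin_setE ?inE/= in_itv/= andbT => c0.
    by rewrite GE.
  apply/esym; apply: integral0_eq => z _; rewrite /G/=.
  by move/negP/negbTE : c0 => ->.
rewrite (fubini_tonelli (m1 := mu) (m2 := @sigma_finite_leb2 R))//.
apply: eq_integral => z _; rewrite -ge0_integralZl_EFin//; last 2 first.
- by move=> c _; rewrite lee_fin.
- apply/measurable_funTS/measurable_EFinP; exact: measurable_fun_pair1 mg.
rewrite [RHS]integral_mkcond; apply: eq_integral => c _.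
rewrite patchE /G/=; case: ifPn => ce; rewrite -EFinM ?[f z * _]mulrC.
  by rewrite ifT// inE/= in_itv.
by rewrite ifF//; apply/negbTE; rewrite notin_setE/= in_itv; apply/negP.
Qed.
End inner.

(** Shifting [x] by [eta] lowers the right half of the loss by [P] and raises the left half by [N].
    By Tonelli the integrals of [P] and [N] are integrals over [c], compared through [le_v]. As [P]
    is at most [W (x z)], its integral is finite when the right-hand side is, and can be
    cancelled. *)
Lemma layer_cake :
  (wint f setT (fun z => (W (x z - eta (d z)))%R) <= wint f setT (W \o x))%E.
Proof.
have [Woo|Wfin] := eqVneq (wint f setT (W \o x)) +oo%E; first by rewrite Woo leey.
have mWx : measurable_fun setT (W \o x) by exact: measurableT_comp mW mx.
have mWp : measurable_fun setT Wp.
  apply: measurableT_comp mW _; exact: measurable_maxr.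
pose P z := Wp (x z) - Wp (x z - eta (d z)).
pose N z := Wp (eta (d z) - x z) - Wp (- x z).
have mP : measurable_fun setT P.
  apply: measurable_funB; first exact: measurableT_comp.
  apply: measurableT_comp mWp _; exact: measurable_funB.
have mN : measurable_fun setT N.
  apply: measurable_funB; apply: measurableT_comp mWp _.
    exact: measurable_funB.
  by apply: measurableT_comp => //; exact: oppr_measurable.
have P0 z : 0 <= P z.
  by rewrite -lee_fin -integral_slope_right//; apply: integral_ge0 => c _; rewrite lee_fin.
have N0 z : 0 <= N z.
  by rewrite -lee_fin -integral_slope_left//; apply: integral_ge0 => c _; rewrite lee_fin.
have Wp0 y : 0 <= Wp y by exact: W_ge0.
have PW z : P z <= W (x z).
  by rewrite loss_split /P; have := Wp0 (- x z); have := Wp0 (x z - eta (d z)); lra.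
have key z : W (x z - eta (d z)) + P z = W (x z) + N z.
  by rewrite !loss_split /P /N opprB; lra.
have NP : (wint f setT N <= wint f setT P)%E.
  have PE : wint f setT P = (\int[mu]_(c in `[0%R, +oo[)
      wint f [set z | (c < eta (d z))%R] (fun z => v (x z - c)))%E.
    rewrite integral_level_wint//; last first.
      apply: measurableT_comp mv _; apply: measurable_funB.
        exact: (measurableT_comp mx measurable_snd).
      exact: measurable_fst.
    by apply: eq_integral => z _; rewrite integral_slope_right// -EFinM mulrC.
  have NE : wint f setT N = (\int[mu]_(c in `[0%R, +oo[)
      wint f [set z | (c < eta (d z))%R] (fun z => v (c - x z)))%E.
    rewrite integral_level_wint//; last first.
      apply: measurableT_comp mv _; apply: measurable_funB.
        exact: measurable_fst.
      exact: (measurableT_comp mx measurable_snd).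
    by apply: eq_integral => z _; rewrite integral_slope_left// -EFinM mulrC.
  have mvx : measurable_fun setT (fun cz : R * (R * R) => v (x cz.2 - cz.1)).
    apply: measurableT_comp mv _; apply: measurable_funB.
      exact: (measurableT_comp mx measurable_snd).
    exact: measurable_fst.
  have mvx' : measurable_fun setT (fun cz : R * (R * R) => v (cz.1 - x cz.2)).
    apply: measurableT_comp mv _; apply: measurable_funB.
      exact: measurable_fst.
    exact: (measurableT_comp mx measurable_snd).
  rewrite PE NE; apply: ge0_le_integral => //.
  - by move=> c _; exact: wint_ge0.
  - exact: (measurable_level_wint mvx').
  - exact: (measurable_level_wint mvx).
  move=> c; rewrite /= in_itv/= andbT => c0.
  apply: (wint_downset_le mf f0 md (S := [set u | c < eta u])) => //.
  - by move=> u w /= cu wu; exact: lt_le_trans cu (eta_ni wu).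
  - exact: measurable_fun_pair2 mvx'.
  - exact: measurable_fun_pair2 mvx.
  - by move=> u; exact: le_v.
have mWxe : measurable_fun setT (fun z => W (x z - eta (d z))).
  apply: measurableT_comp mW _; exact: measurable_funB.
have wintD (phi chi : R * R -> R) : measurable_fun setT phi -> measurable_fun setT chi ->
    (forall z, 0 <= phi z) -> (forall z, 0 <= chi z) ->
    wint f setT (fun z => phi z + chi z) = (wint f setT phi + wint f setT chi)%E.
  move=> mp mc p0 c0; rewrite /wint -ge0_integralD//.
  - by apply: eq_integral => z _; rewrite mulrDl EFinD.
  - by move=> z _; rewrite lee_fin mulr_ge0.
  - exact/measurable_EFinP/measurable_funM.
  - by move=> z _; rewrite lee_fin mulr_ge0.
  - exact/measurable_EFinP/measurable_funM.
have Pfin : wint f setT P \is a fin_num.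
  rewrite ge0_fin_numE; last exact: wint_ge0.
  apply: (@le_lt_trans _ _ (wint f setT (W \o x))).
    by apply: le_wint => // z _; exact: PW.
  by rewrite ltey.
rewrite -(@leeD2rE _ (wint f setT P))// -wintD//.
rewrite (_ : (fun z => _ + P z) = fun z => (W \o x) z + N z); last first.
  by apply/funext => z; exact: key.
rewrite wintD//; last by move=> z; exact: W_ge0.
exact: leeD.
Qed.
End layer_cake.

(** * The integral condition expressed through the slope [v] *)

Section integral_ae.
Context d (T : measurableType d) (R : realType).
Local Open Scope ereal_scope.
Variable mu : {measure set T -> \bar R}.

(* The integral of a nonnegative function is a supremum over simple functions
   below it, so neither monotonicity here nor, in the next lemma, changing a
   measurable function on a null set needs [phi] to be measurable; this is
   applied to [derive1 W], whose measurability is not known. *)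
Lemma ge0_le_integral_nomeas (phi chi : T -> \bar R) :
  (forall x, 0 <= phi x) -> (forall x, phi x <= chi x) ->
  \int[mu]_x phi x <= \int[mu]_x chi x.
Proof.
move=> p0 pc; have c0 x : 0 <= chi x by exact: le_trans (p0 x) (pc x).
rewrite !ge0_integralTE//; apply: ereal_sup_le => _ [h /= hp <-].
by exists h => // x; exact: le_trans (hp x) (pc x).
Qed.

Lemma ge0_integral_negligible_eq (phi chi : T -> \bar R) :
  measurable_fun setT chi ->
  (forall x, 0 <= phi x) -> (forall x, 0 <= chi x) ->
  mu.-negligible [set x | phi x <> chi x] ->
  \int[mu]_x phi x = \int[mu]_x chi x.
Proof.
move=> mc p0 c0 [N [mN N0 pcN]].
have pc x : ~ N x -> phi x = chi x.
  by move=> Nx; apply: contrapT => /pcN.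
have mext (k : \bar R) : measurable_fun setT (fun x => if x \in N then k else chi x).
  apply: measurable_fun_ifT => //; apply: (measurable_fun_bool true).
  rewrite setTI (_ : _ @^-1` _ = N)//.
  by apply/seteqP; split => x /=; [move/set_mem|exact: mem_set].
have ext (k : \bar R) : 0 <= k ->
    \int[mu]_x (if x \in N then k else chi x) = \int[mu]_x chi x.
  move=> k0; apply: ge0_ae_eq_integral => //.
    by move=> x _; case: ifP.
  exists N; split => // x /=; apply: contra_notP => Nx _.
  by rewrite memNset.
apply/eqP; rewrite eq_le; apply/andP; split.
  rewrite -(ext +oo)//; apply: ge0_le_integral_nomeas => // x.
  by case: ifPn => [_|/negP]; rewrite ?leey// inE => /pc ->.
rewrite -(ext 0)//; apply: ge0_le_integral_nomeas => x.
  by case: ifP.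
by case: ifPn => // /negP; rewrite inE => /pc ->.
Qed.

(** The factor may be negative and the integral infinite, so linearity for integrable functions does
    not cover this; a negative factor is treated through the opposite integrand. *)
Lemma integralZl_ge0_fun (D : set T) (k : R) (h : T -> R) :
  measurable D -> measurable_fun D h -> (forall x, 0 <= h x)%R ->
  \int[mu]_(x in D) (k * h x)%:E = k%:E * \int[mu]_(x in D) (h x)%:E.
Proof.
move=> mD mh h0; have [k0|k0] := leP 0%R k.
  rewrite -ge0_integralZl_EFin//; last exact/measurable_EFinP.
  by move=> x _; rewrite lee_fin.
have k0' : (0 <= - k)%R by rewrite oppr_ge0 ltW.
transitivity (\int[mu]_(x in D) (- ((- k) * h x)%:E)).
  by apply: eq_integral => x _; rewrite mulNr EFinN oppeK.
rewrite integral_ge0N; last by move=> x _; rewrite lee_fin mulr_ge0.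
rewrite (eq_integral (fun x => (- k)%:E * (h x)%:E)); last by move=> x _; rewrite EFinM.
rewrite ge0_integralZl_EFin//.
- by rewrite EFinN mulNe oppeK.
- by move=> x _; rewrite lee_fin.
- exact/measurable_EFinP.
Qed.
End integral_ae.

Lemma negligible_shift (R : realType) (c : R) (N : set R) :
  (@lebesgue_measure R).-negligible N ->
  (@lebesgue_measure R).-negligible ((fun x => x + c) @^-1` N).
Proof.
move=> [A [mA A0 NA]]; exists ((fun x => x + c) @^-1` A); split => //.
- rewrite -[X in measurable X]setTI; exact: measurable_shift.
- by rewrite -A0; exact: lebesgue_measure_shift.
- by move=> x /NA.
Qed.

Section cond_int.
Context {R : realType}.
Local Notation mu := (@lebesgue_measure R).
Variables (W v psi : R -> R) (f : R * R -> R).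
Hypothesis v0 : forall x, 0 <= v x.
Hypothesis vnd : {homo v : x y / x <= y}.
Hypothesis vneg : forall x, x <= 0 -> v x = 0.
Hypothesis Wv : mu.-negligible [set x | derive1 W x <> v x - v (- x)].
Hypothesis mf : measurable_fun setT f.
Hypothesis f0 : forall z, 0 <= f z.

Let mv : measurable_fun setT v.
Proof. exact: nondecreasing_measurable. Qed.

Let F (t s : R) : \bar R := (\int[mu]_(y in `]-oo, t]) (f (s, s + y))%:E)%E.

Let mshear : measurable_fun setT (fun z : R * R => (z.1, z.1 + z.2)).
Proof.
apply: measurable_fun_pair; first exact: measurable_fst.
by apply: measurable_funD; [exact: measurable_fst|exact: measurable_snd].
Qed.

Let mfs (s : R) : measurable_fun setT (fun y : R => f (s, s + y)).
Proof. exact: (measurable_fun_pair2 s (measurableT_comp mf mshear)). Qed.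

Let F0 (t s : R) : (0 <= F t s)%E.
Proof. by apply: integral_ge0 => y _; rewrite lee_fin. Qed.

Let mF t : measurable_fun setT (F t).
Proof.
pose g (z : R * R) : \bar R := (if z.2 <= t then f (z.1, z.1 + z.2) else 0)%:E.
have -> : F t = fun s => (\int[mu]_y g (s, y))%E.
  apply/funext => s; rewrite /F integral_mkcond; apply: eq_integral => y _.
  by rewrite patchE mem_setE in_itv/= /g/=; case: ifP.
apply: (measurable_fun_fubini_tonelli_F (m2 := mu)).
  apply/measurable_EFinP; apply: measurable_fun_ifT => //.
    by apply: measurable_fun_ler => //; exact: measurable_snd.
  exact: (measurableT_comp mf mshear).
by move=> z; rewrite /g; case: ifP; rewrite lee_fin.
Qed.

Let wintE t (h : R -> R) : measurable_fun setT h -> (forall x, 0 <= h x) ->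
  (\int[mu]_s ((h s)%:E * F t s) =
   wint f [set z | (z.2 - z.1 <= t)%R] (h \o fst))%E.
Proof.
move=> mh h0; rewrite /wint [RHS]integral_mkcond leb2_tonelli; last 2 first.
- apply: (measurable_restrictT (fun z => ((h \o fst) z * f z)%:E) _).1.
    have md : measurable_fun setT (fun z : R * R => z.2 - z.1).
      by apply: measurable_funB; [exact: measurable_snd|exact: measurable_fst].
    rewrite (_ : [set z | _] = (fun z : R * R => z.2 - z.1) @^-1` `]-oo, t]%classic).
      by rewrite -[X in measurable X]setTI; exact: md.
    by apply/seteqP; split => z /=; rewrite in_itv.
  apply/measurable_funTS/measurable_EFinP/measurable_funM => //.
  exact: measurableT_comp mh measurable_fst.
- by move=> z; rewrite patchE; case: ifP => // _; rewrite lee_fin mulr_ge0//=.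
apply: eq_integral => s _.
rewrite /F -(integralZl_ge0_fun _ (h s))//; last exact: (measurable_funTS (mfs s)).
rewrite integral_mkcond.
pose g y : \bar R := (if y - s <= t then h s * f (s, y) else 0)%:E.
transitivity (\int[mu]_y g y)%E; last first.
  apply: eq_integral => y _; rewrite patchE /g/=; case: ifPn => [yt|/negP yt].
    by rewrite mem_set.
  by rewrite memNset.
(* Translating by [s] turns the second coordinate into the difference of the coordinates, the
   variable of the inner integral in [F]. *)
rewrite -(ge0_integral_shift s); last 2 first.
- apply/measurable_EFinP; apply: measurable_fun_ifT => //.
    by apply: measurable_fun_ler => //; exact: measurable_funB.
  by apply: measurable_funM => //; exact: measurable_fun_pair2.
- by move=> y; rewrite /g; case: ifP; rewrite lee_fin// mulr_ge0.
apply: eq_integral => y _; rewrite patchE mem_setE in_itv/= /g addrK.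
by rewrite [s + y]addrC; case: ifP.
Qed.

(* When both parts are infinite the right-hand side is [+oo - +oo = -oo]. *)
Lemma cond_intE t : cond_int W f psi t =
  (wint f [set z | (z.2 - z.1 <= t)%R] (fun z => v (z.1 - psi t)) -
   wint f [set z | (z.2 - z.1 <= t)%R] (fun z => v (psi t - z.1)))%E.
Proof.
set c := psi t.
transitivity (\int[mu]_s ((derive1 W (s - c))%:E * F t s))%E.
  apply: eq_integral => s _; rewrite (integralZl_ge0_fun _ (derive1 W (s - c)))//.
  exact: (measurable_funTS (mfs s)).
have mvl : measurable_fun setT (fun s : R => v (s - c)).
  by apply: measurableT_comp mv _; exact: measurable_funB.
have mvr : measurable_fun setT (fun s : R => v (c - s)).
  by apply: measurableT_comp mv _; exact: measurable_funB.
have negl : mu.-negligible [set s | derive1 W (s - c) <> v (s - c) - v (c - s)].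
  have := negligible_shift (- c) Wv; rewrite (_ : _ @^-1` _ =
     [set s | derive1 W (s - c) <> v (s - c) - v (c - s)])//.
  by apply/seteqP; split => s /=; rewrite opprB.
(* Since [v] vanishes on the left half-line, at most one of [v (s - c)] and [v (c - s)] is nonzero,
   so they are almost everywhere the positive and negative parts of the derivative. *)
rewrite integralE.
rewrite -(wintE t mvl)// -(wintE t mvr)//; congr (_ - _)%E.
- apply: ge0_integral_negligible_eq.
  + by apply: emeasurable_funM; [exact/measurable_EFinP|exact: mF].
  + by move=> s; exact: funepos_ge0.
  + by move=> s; rewrite mule_ge0// lee_fin.
  + move: negl => [A [mA A0 NA]]; exists A; split => // s /= neq; apply: NA => /= E.
    apply: neq; rewrite funeposE E; have [sc|sc] := leP s c.
      rewrite (vneg (x := s - c)) ?subr_le0// sub0r mul0e max_r//.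
      by rewrite EFinN mulNe oppe_le0 mule_ge0// lee_fin.
    rewrite (vneg (x := c - s)) ?subr_le0 ?ltW// subr0 max_l//.
    by rewrite mule_ge0// lee_fin.
- apply: ge0_integral_negligible_eq.
  + by apply: emeasurable_funM; [exact/measurable_EFinP|exact: mF].
  + by move=> s; exact: funeneg_ge0.
  + by move=> s; rewrite mule_ge0// lee_fin.
  + move: negl => [A [mA A0 NA]]; exists A; split => // s /= neq; apply: NA => /= E.
    apply: neq; rewrite funenegE E; have [sc|sc] := leP s c.
      rewrite (vneg (x := s - c)) ?subr_le0// sub0r EFinN mulNe oppeK max_l//.
      by rewrite mule_ge0// lee_fin.
    rewrite (vneg (x := c - s)) ?subr_le0 ?ltW// subr0 mul0e max_r//.
    by rewrite oppe_le0 mule_ge0// lee_fin.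
Qed.
End cond_int.

(** * Comparing the two slope integrals on sublevel sets of the difference *)

Section comparison.
Context {R : realType}.
Local Notation mu := (@lebesgue_measure R).
Variables (W v : R -> R) (f : R * R -> R).
Hypothesis W_ge0 : forall t, 0 <= W t.
Hypothesis mW : measurable_fun setT W.
Hypothesis v0 : forall x, 0 <= v x.
Hypothesis vnd : {homo v : x y / x <= y}.
Hypothesis vneg : forall x, x <= 0 -> v x = 0.
Hypothesis vW : forall a b, 0 <= a -> a <= b ->
  (\int[mu]_(t in `[a, b]) (v t)%:E = (W b - W a)%:E)%E.
Hypothesis mf : measurable_fun setT f.
Hypothesis f0 : forall z, 0 <= f z.
Hypothesis f_swap : forall z1 z2 : R, f (z1, z2) = f (z2, z1).
Hypothesis f_neg : forall z1 z2 : R, f (z1, z2) = f (- z1, - z2).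

Let mv : measurable_fun setT v.
Proof. exact: nondecreasing_measurable. Qed.

Let B (t : R) : set (R * R) := [set z | (z.2 - z.1 <= t)%R].

Let mB t : measurable (B t).
Proof.
have md : measurable_fun setT (fun z : R * R => z.2 - z.1).
  by apply: measurable_funB; [exact: measurable_snd|exact: measurable_fst].
rewrite (_ : B t = (fun z : R * R => z.2 - z.1) @^-1` `]-oo, t]%classic).
  by rewrite -[X in measurable X]setTI; exact: md.
by apply/seteqP; split => z /=; rewrite in_itv.
Qed.

Let BS s t : s <= t -> B s `<=` B t.
Proof. by move=> st z /= /le_trans; apply. Qed.

Let mvp (g : R * R -> R) : measurable_fun setT g -> measurable_fun setT (fun z => v (g z)).
Proof. exact: measurableT_comp. Qed.

Let m1D c : measurable_fun setT (fun z : R * R => v (z.1 + c)).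
Proof. by apply: mvp; apply: measurable_funD => //; exact: measurable_fst. Qed.
Let m1B c : measurable_fun setT (fun z : R * R => v (z.1 - c)).
Proof. by apply: mvp; apply: measurable_funB => //; exact: measurable_fst. Qed.
Let mB1 c : measurable_fun setT (fun z : R * R => v (c - z.1)).
Proof. by apply: mvp; apply: measurable_funB => //; exact: measurable_fst. Qed.
Let m2D c : measurable_fun setT (fun z : R * R => v (z.2 + c)).
Proof. by apply: mvp; apply: measurable_funD => //; exact: measurable_snd. Qed.
Let m2B c : measurable_fun setT (fun z : R * R => v (z.2 - c)).
Proof. by apply: mvp; apply: measurable_funB => //; exact: measurable_snd. Qed.

Lemma wint_swap (A : set (R * R)) (phi : R * R -> R) : measurable A -> measurable_fun setT phi ->
  (forall z, 0 <= phi z) ->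
  wint f [set z | A (z.2, z.1)] (fun z => phi (z.2, z.1)) = wint f A phi.
Proof.
move=> mA mp p0; apply: (wint_map (S := fun z => (z.2, z.1)) mf f0) => //.
- by apply: measurable_fun_pair; [exact: measurable_snd|exact: measurable_fst].
- by move=> g mg g0; exact: leb2_swap.
- by move=> [z1 z2] /=; rewrite f_swap.
Qed.

Lemma wint_antiswap (A : set (R * R)) (phi : R * R -> R) : measurable A -> measurable_fun setT phi ->
  (forall z, 0 <= phi z) ->
  wint f [set z | A (- z.2, - z.1)] (fun z => phi (- z.2, - z.1)) = wint f A phi.
Proof.
move=> mA mp p0; apply: (wint_map (S := fun z => (- z.2, - z.1)) mf f0) => //.
- apply: measurable_fun_pair.
    by apply: measurableT_comp; [exact: oppr_measurable|exact: measurable_snd].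
  by apply: measurableT_comp; [exact: oppr_measurable|exact: measurable_fst].
- move=> g mg g0; rewrite -[RHS]leb2_oppr// -[RHS]leb2_swap//.
  have ms : measurable_fun setT (fun z : R * R => (- z.1, - z.2)).
    apply: measurable_fun_pair.
      by apply: measurableT_comp; [exact: oppr_measurable|exact: measurable_fst].
    by apply: measurableT_comp; [exact: oppr_measurable|exact: measurable_snd].
  exact: measurableT_comp mg ms.
- by move=> [z1 z2] /=; rewrite -f_neg f_swap.
Qed.

(** The reflection keeps [z.2 - z.1], hence [B t], and makes the integrand nondecreasing in a
    coordinate, so that it can be compared pointwise with the other one. *)
Let reflect_neg c t :
  wint f (B t) (fun z => v (c - z.1)) = wint f (B t) (fun z => v (z.2 + c)).
Proof.
rewrite -(wint_antiswap (mB t) (mB1 c)) => [|z]; last exact: v0.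
congr (wint _ _ _); first by apply/seteqP; split => z; rewrite /B/= opprK addrC.
by apply/funext => z /=; rewrite opprK addrC.
Qed.

(* After reflection the two integrands are [v (z.1 - c0)] and [v (z.2 + c0)],
   whose order changes once, at [z.2 - z.1 = - 2 * c0]. *)
Lemma sign_change_ge0 c0 c u t : 0 <= c -> c <= c0 -> t <= u ->
  (0 <= wint f (B u) (fun z => v (z.1 - c0)) -
        wint f (B u) (fun z => v (c0 - z.1)))%E ->
  (wint f (B t) (fun z => v (c - z.1)) <= wint f (B t) (fun z => v (z.1 - c)))%E.
Proof.
move=> c_ge0 cc0 tu cond.
(* An infinite negative part would make the difference [-oo], even against an infinite positive
   part, contradicting [cond]. *)
have Nfin : (wint f (B u) (fun z => v (c0 - z.1)) < +oo)%E.
  rewrite ltey; apply/eqP => Noo; move: cond; rewrite Noo.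
  by rewrite addeNy leeNy_eq.
have NP : (wint f (B u) (fun z => v (c0 - z.1)) <=
           wint f (B u) (fun z => v (z.1 - c0)))%E.
  rewrite -suber_ge0// ge0_fin_numE//; exact: wint_ge0.
(* Raising the level from [c] to [c0] increases the left side and decreases the right side, so it
   suffices to treat level [c0]. *)
apply: (@le_trans _ _ (wint f (B t) (fun z => v (c0 - z.1)))).
  by apply: le_wint => // z _; apply: vnd; lra.
apply: (@le_trans _ _ (wint f (B t) (fun z => v (z.1 - c0)))); last first.
  by apply: le_wint => // z _; apply: vnd; lra.
(* Up to the crossing point the inequality is pointwise. Beyond it the integrands are reversed on
   [B u] outside [B t], so that part can be cancelled from the inequality on [B u]. *)
rewrite reflect_neg; have [tc|ct] := leP t (- (2 * c0)).
  by apply: le_wint => // z; rewrite /B/= => zt; apply: vnd; lra.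
apply: (wint_cancel mf f0 (mB t) (mB u)) => //.
- exact: BS.
- by move=> z [_ /negP]; rewrite -ltNge => zt; apply: vnd; lra.
- by rewrite -reflect_neg.
- apply: le_lt_trans Nfin; rewrite reflect_neg.
  rewrite [leRHS](wint_setD mf f0 (mB t) (mB u))//; last exact: BS.
  by rewrite leeDr// wint_ge0.
Qed.

(** [W] grows by the integral of the nondecreasing [v] over [[y - k, y]], which is at least [k]
    times the value at the left end. This turns a finite risk into a finite slope integral. *)
Lemma slope_le_loss k y : 0 < k -> v (y - k) * k <= W y.
Proof.
move=> k0; have [yk|ky] := leP (y - k) 0; first by rewrite vneg// mul0r.
apply: (@le_trans _ _ (W y - W (y - k))); last by rewrite gerBl.
rewrite -lee_fin -vW; [|exact: ltW|by rewrite gerBl ltW].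
have <- : (\int[mu]_(t in `[(y - k)%R, y]) (v (y - k))%:E = (v (y - k) * k)%:E)%E.
  have muk : mu `[y - k, y]%classic = k%:E.
    rewrite lebesgue_measure_itv/= lte_fin gtrBl k0 -EFinD.
    by rewrite opprB subrKC.
  transitivity ((v (y - k))%:E * mu `[(y - k)%R, y]%classic)%E.
    exact: (integral_cst mu (measurable_itv `[(y - k)%R, y])).
  by rewrite muk.
apply: (ge0_le_integral mu (measurable_itv `[(y - k)%R, y])) => //.
- by move=> t _; rewrite lee_fin.
- exact/measurable_EFinP/measurable_funTS.
- by move=> t /=; rewrite in_itv/= => /andP[h _]; rewrite lee_fin vnd.
Qed.

(* For [u <= 0] the integrand of the positive part dominates that of the
   reflected negative part on [B u], so the assumed inequality forces them to
   agree almost everywhere. The finite risk rules out [+oo - +oo = -oo]. *)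
Lemma degenerate_le k c u E : 0 < k -> 0 <= c -> c <= k -> u <= 0 ->
  (wint f setT (W \o snd) < +oo)%E ->
  (wint f (B u) (fun z => v (z.1 + k)) -
   wint f (B u) (fun z => v (- k - z.1)) <= 0)%E ->
  measurable E -> E `<=` B u ->
  (wint f E (fun z => v (z.1 + c)) <= wint f E (fun z => v (z.2 - c)))%E.
Proof.
move=> k0 c0 ck u0 Wfin cond mE EB.
have mWs : measurable_fun setT (fun z : R * R => k^-1 * W z.2).
  by apply: measurable_funM => //; exact: measurableT_comp mW measurable_snd.
have Nfin : (wint f (B u) (fun z => v (z.2 - k)) < +oo)%E.
  apply: (@le_lt_trans _ _ (wint f setT (fun z => k^-1 * W z.2))).
    apply: (@le_trans _ _ (wint f (B u) (fun z => k^-1 * W z.2))).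
      apply: le_wint => // z _; rewrite -[leRHS]mulrC ler_pdivlMr//.
      exact: slope_le_loss.
    rewrite [leRHS](wint_setD mf f0 (mB u) measurableT)//; last first.
      by move=> z; rewrite mulr_ge0// invr_ge0 ltW.
    by rewrite leeDl// wint_ge0// => z; rewrite mulr_ge0// invr_ge0 ltW.
  rewrite (_ : wint f setT _ = k^-1%:E * wint f setT (W \o snd))%E.
    by rewrite lte_mul_pinfty// lee_fin invr_ge0 ltW.
  rewrite /wint -ge0_integralZl_EFin//.
  - by apply: eq_integral => z _; rewrite -EFinM mulrA.
  - by move=> z _; rewrite lee_fin mulr_ge0/=.
  - apply/measurable_EFinP/measurable_funM => //.
    exact: measurableT_comp mW measurable_snd.
  - by rewrite invr_ge0 ltW.
have NE : wint f (B u) (fun z => v (- k - z.1)) =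
    wint f (B u) (fun z => v (z.2 - k)) by exact: reflect_neg.
have PN : (wint f (B u) (fun z => v (z.1 + k)) <=
           wint f (B u) (fun z => v (z.2 - k)))%E.
  by rewrite -sube_le0 -NE.
have Pfin := le_lt_trans PN Nfin.
apply: (@le_trans _ _ (wint f E (fun z => v (z.1 + k)))).
  by apply: le_wint => // z _; apply: vnd; lra.
apply: (@le_trans _ _ (wint f E (fun z => v (z.2 - k)))); last first.
  by apply: le_wint => // z _; apply: vnd; lra.
(* On [B u] with [u <= 0] one has [z.2 - k <= z.1 + k], so the part of [B u] outside [E] can be
   cancelled. *)
apply: (wint_cancel mf f0 mE (mB u)) => //.
- by move=> z [Bz _]; move: Bz; rewrite /B/= => Bz; apply: vnd; lra.
- apply: le_lt_trans Pfin; rewrite [leRHS](wint_setD mf f0 mE (mB u))//.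
  by rewrite leeDr// wint_ge0.
Qed.

(** For [t <= 0] the degenerate comparison applies directly. For [t > 0] the band
    [0 < z.2 - z.1 <= t] remains: there [z.1 + c] is raised to [z.2 + c], exchanging coordinates
    moves the band into [B 0] for the degenerate comparison, and the resulting [z.1 - c] is raised
    to [z.2 - c]. *)
Lemma sign_change_le0 (k : R -> R) c u t :
  {homo k : x y / x <= y >-> y <= x} ->
  (wint f setT (W \o snd) < +oo)%E ->
  (forall s, (wint f (B s) (fun z => v (z.1 + k s)) -
   wint f (B s) (fun z => v (- k s - z.1)) <= 0)%E) ->
  0 <= c -> c < k u -> t <= u ->
  (wint f (B t) (fun z => v (z.1 + c)) <= wint f (B t) (fun z => v (- c - z.1)))%E.
Proof.
move=> kni Wfin cond c0 cku tu.
rewrite (reflect_neg (- c)).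
have [t0|t0] := leP t 0.
  (* The degenerate comparison needs a threshold at most 0; lowering [u] keeps [c] below [k], which
     is nonincreasing, and keeps [t] below the threshold. *)
  pose u' := Num.min u 0.
  have ku' : c < k u' by apply: lt_le_trans cku (kni _ _ _); rewrite ge_min lexx.
  apply: (@degenerate_le (k u') c u') => //.
  - exact: le_lt_trans ku'.
  - exact: ltW.
  - by rewrite ge_min lexx orbT.
  - by apply: BS; rewrite le_min tu t0.
have ck0 : c < k 0 by apply: lt_le_trans cku (kni _ _ _); lra.
have deg E : measurable E -> E `<=` B 0 ->
    (wint f E (fun z => v (z.1 + c)) <= wint f E (fun z => v (z.2 - c)))%E.
  move=> mE EB; apply: (@degenerate_le (k 0) c 0) => //.
  - exact: le_lt_trans ck0.
  - exact: ltW.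
have mD : measurable (B t `\` B 0) by exact: measurableD.
rewrite !(wint_setD mf f0 (mB 0) (mB t) (BS (ltW t0)))//; apply: leeD.
  exact: deg.
apply: (@le_trans _ _ (wint f (B t `\` B 0) (fun z => v (z.2 + c)))).
  apply: le_wint => // z [_ /negP]; rewrite -ltNge => z0; apply: vnd; lra.
apply: (@le_trans _ _ (wint f (B t `\` B 0) (fun z => v (z.1 - c)))); last first.
  apply: le_wint => // z [_ /negP]; rewrite -ltNge => z0; apply: vnd; lra.
rewrite -(wint_swap mD (m2D c))// -(wint_swap mD (m1B c))//=.
apply: deg.
  have ms : measurable_fun setT (fun z : R * R => (z.2, z.1)).
    by apply: measurable_fun_pair; [exact: measurable_snd|exact: measurable_fst].
  by have := ms measurableT _ mD; rewrite setTI.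
by move=> z [_ /negP]; rewrite /B/= -ltNge => z0; lra.
Qed.
End comparison.

(** * The sign of the shift, the symmetrised risk and the conclusion *)

Lemma ge0_of_nonincreasing_cvg0 (R : realType) (psi : R -> R) :
  {homo psi : x y / x <= y >-> y <= x} ->
  psi x @[x --> +oo] --> (0 : R) -> forall t, 0 <= psi t.
Proof.
move=> ni cv t; rewrite leNgt; apply/negP => pt.
have /cvgrPdist_lt/(_ (- psi t)) := cv; rewrite oppr_gt0 => /(_ pt) H.
have [s [ts]] : exists s, t <= s /\ `|0 - psi s| < - psi t.
  near (pinfty_nbhs R) => s; exists s; split; last by near: s.
  by near: s; apply: nbhs_pinfty_ge; exact: num_real.
rewrite sub0r normrN => /ltr_normlP[+ _]; have := ni _ _ ts; lra.
Unshelve. all: by end_near. Qed.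
Section risk.
Context {R : realType}.
Variables (W psi : R -> R) (f : R * R -> R).
Hypothesis W_ge0 : forall t, 0 <= W t.
Hypothesis W_even : forall t, W t = W (- t).
Hypothesis mW : measurable_fun setT W.
Hypothesis mpsi : measurable_fun setT psi.
Hypothesis mf : measurable_fun setT f.
Hypothesis f0 : forall z, 0 <= f z.
Hypothesis f_swap : forall z1 z2 : R, f (z1, z2) = f (z2, z1).
Hypothesis f_neg : forall z1 z2 : R, f (z1, z2) = f (- z1, - z2).

Lemma risk_delta_psi (theta : R * R) :
  let loss1 (z : R * R) := W (z.1 - psi (z.2 - z.1 + (theta.2 - theta.1))) in
  risk W f theta (delta_psi psi) = (wint f setT loss1 + wint f setT loss1)%E.
Proof.
move=> loss1; pose lam := theta.2 - theta.1.
pose loss2 (z : R * R) := W (z.2 + psi (z.2 - z.1 + lam)).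
have mp : measurable_fun setT (fun z : R * R => psi (z.2 - z.1 + lam)).
  apply: measurableT_comp mpsi _; apply: measurable_funD => //.
  by apply: measurable_funB; [exact: measurable_snd|exact: measurable_fst].
have ml1 : measurable_fun setT loss1.
  by apply: measurableT_comp mW _; apply: measurable_funB => //; exact: measurable_fst.
have ml2 : measurable_fun setT loss2.
  by apply: measurableT_comp mW _; apply: measurable_funD => //; exact: measurable_snd.
have -> : risk W f theta (delta_psi psi) =
    (\int[@leb2 R]_z ((loss1 z + loss2 z) * f z)%:E)%E.
  (* Translating by [theta] centres the density; the observed difference becomes
     [z.2 - z.1 + lam]. *)
  rewrite -[RHS](leb2_shift _ _ (- theta.1) (- theta.2)).
  - apply: eq_integral => z _; rewrite /loss1 /loss2 /delta_psi /lam /=.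
    have -> : z.2 - theta.2 - (z.1 - theta.1) + (theta.2 - theta.1) = z.2 - z.1 by ring.
    by congr (((W _ + W _) * _)%:E); ring.
  - by apply/measurable_EFinP/measurable_funM => //; exact: measurable_funD.
  - by move=> z; rewrite lee_fin; apply: mulr_ge0 => //; apply: addr_ge0; exact: W_ge0.
transitivity (wint f setT loss1 + wint f setT loss2)%E.
  rewrite /wint -ge0_integralD//.
  - by apply: eq_integral => z _; rewrite mulrDl EFinD.
  - by move=> z _; rewrite lee_fin; apply: mulr_ge0 => //; exact: W_ge0.
  - exact/measurable_EFinP/measurable_funM.
  - by move=> z _; rewrite lee_fin; apply: mulr_ge0 => //; exact: W_ge0.
  - exact/measurable_EFinP/measurable_funM.
congr (_ + _)%E; rewrite -[RHS](wint_antiswap mf f0 f_swap f_neg measurableT ml1); last first.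
  by move=> z; exact: W_ge0.
by congr (wint _ _ _); apply/funext => z; rewrite /loss1 /loss2/= W_even; congr W; rewrite opprK [- z.1 + _]addrC opprD.
Qed.

End risk.

Theorem theorem2p2p1 (R : realType) (f : R * R -> R) (W : R -> R) (psi : R -> R)
  (hf : prob_density2 f)
  (hf_swap : forall z1 z2 : R, f (z1, z2) = f (z2, z1))
  (hf_neg : forall z1 z2 : R, f (z1, z2) = f (- z1, - z2))
  (hW_ge0 : forall t : R, 0 <= W t)
  (hW_ac : abs_continuous W)
  (hW0 : W 0 = 0)
  (hW_even : forall t : R, W t = W (- t))
  (hW_dec : {in `]-oo, 0[ &, forall x y : R, x < y -> W y < W x})
  (hW_inc : {in `]0, +oo[ &, forall x y : R, x < y -> W x < W y})
  (hW'_inc : exists N : set R, (@lebesgue_measure R).-negligible N /\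
       {in ~` N &, forall x y : R, x <= y -> derive1 W x <= derive1 W y})
  (hpsi_lim : psi x @[x --> +oo] --> (0 : R))
  (hab : ({homo psi : x y / x <= y >-> y <= x} /\ (forall t : R, (0 <= cond_int W f psi t)%E))
      \/ ({homo psi : x y / x <= y} /\ (forall t : R, (cond_int W f psi t <= 0)%E))) :
  forall theta : R * R, theta.1 <= theta.2 ->
    (risk W f theta (delta_psi psi) <= risk W f theta (@delta0 R))%E.
Proof.
move=> theta theta12.
have [mf [f0 _]] := hf.
have [v [v0 vnd vneg vW Wv]] := loss_slope hW_ge0 hW_ac hW0 hW_even hW_inc hW'_inc.
have mW : measurable_fun setT W.
  by apply: continuous_measurable_fun; exact: abs_continuous_continuous.
have mpsi : measurable_fun setT psi.
  by case: hab => -[mono _]; [exact: nonincreasing_measurable|exact: nondecreasing_measurable].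
(* With the zero shift the same formula serves for both risks. *)
have -> : @delta0 R = delta_psi (fun=> 0).
  by apply/funext => -[x1 x2]; rewrite /delta0 /delta_psi/= subr0 addr0.
rewrite !risk_delta_psi//=; set lam := theta.2 - theta.1.
have lam0 : 0 <= lam by rewrite subr_ge0.
suff : (wint f setT (fun z => W (z.1 - psi (z.2 - z.1 + lam))%R) <=
        wint f setT (W \o fst))%E.
  have -> : (fun z : R * R => W (z.1 - 0)) = W \o fst by apply/funext => z /=; rewrite subr0.
  by move=> le; exact: leeD.
have levelE u : [set z : R * R | z.2 - z.1 + lam <= u] = [set z | z.2 - z.1 <= u - lam].
  by apply/seteqP; split => z /=; rewrite lerBrDr.
have condE t := cond_intE psi v0 vnd vneg Wv mf f0 t.
case: hab => -[mono cond].
- have psi0 := ge0_of_nonincreasing_cvg0 mono hpsi_lim.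
  apply: (layer_cake hW0 hW_ge0 hW_even mW v0 vnd vneg vW mf f0 measurable_fst psi0 mono).
  move=> c u c0 cu; rewrite levelE.
  (* The hypothesis is used at [u], where the level is [psi u], while the comparison is wanted at
     [u - lam]; the order of the parameters enters through [lam >= 0]. *)
  apply: (sign_change_ge0 v0 vnd mf f0 hf_swap hf_neg c0 (ltW cu) (u := u)).
    by rewrite gerBl.
  by rewrite -condE.
have [Woo|Wfin] := eqVneq (wint f setT (W \o fst)) +oo%E; first by rewrite Woo leey.
(* Case (b) is reduced to a nonnegative nonincreasing shift: by evenness [W (z.1 - psi t)] equals
   [W (- z.1 - k t)], so the layer argument is applied to the coordinate [- z.1]. *)
pose k t := - psi t.
have kni : {homo k : x y / x <= y >-> y <= x} by move=> x y /mono; rewrite lerN2.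
have k0 : forall t, 0 <= k t.
  apply: ge0_of_nonincreasing_cvg0 => //.
  by rewrite -oppr0; exact: cvgN.
have mWf : measurable_fun setT (W \o (fst : R * R -> R)).
  exact: measurableT_comp mW measurable_fst.
have W2fin : (wint f setT (W \o snd) < +oo)%E.
  rewrite (_ : wint _ _ _ = wint f setT (W \o fst)) ?ltey//.
  rewrite -[RHS](wint_swap mf f0 hf_swap measurableT mWf)//.
  by move=> z; exact: hW_ge0.
have mN1 : measurable_fun setT (fun z : R * R => - z.1).
  by apply: measurableT_comp; [exact: oppr_measurable|exact: measurable_fst].
have := layer_cake hW0 hW_ge0 hW_even mW v0 vnd vneg vW (lam := lam) mf f0 mN1 k0 kni.
rewrite (_ : (fun z : R * R => W (- z.1 - _)) =
    fun z => W (z.1 - psi (z.2 - z.1 + lam))); last first.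
  by apply/funext => z; rewrite hW_even; congr W; rewrite /k; ring.
rewrite (_ : W \o (fun z : R * R => - z.1) = W \o fst); last first.
  by apply/funext => z /=; rewrite [RHS]hW_even.
apply=> c u c0 cu; rewrite levelE.
rewrite (_ : (fun z : R * R => v (c - - z.1)) = fun z => v (z.1 + c)); last first.
  by apply/funext => z; rewrite opprK addrC.
rewrite (_ : (fun z : R * R => v (- z.1 - c)) = fun z => v (- c - z.1)); last first.
  by apply/funext => z; rewrite addrC.
apply: (sign_change_le0 hW_ge0 mW v0 vnd vneg vW mf f0 hf_swap hf_neg kni W2fin _ c0 cu).
  by move=> s; have := cond s; rewrite condE /k opprK.
by rewrite gerBl.
Qed.
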